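(* Suppose that there are constants $c>0$ and $Q>0$ such that $$\frac{\mu(B(y,r))}{\mu(B(x,R))}\ge c\Big(\frac rR\Big)^Q\quad\text{for every } x\in\mathcal P,\ 0<r\le R,\ y\in B(x,R).$$ Let $\Phi:[0,\infty)\to[0,\infty)$ be a continuous increasing function that is doubling, i.e. there is a constant $C$ with $\Phi(2t)\le C\Phi(t)$ for every $t>0$, and suppose that there is a constant $C'\ge1$ with $\Phi(t/C')\le\Phi(t)/2$ for every $t>0$. Let $0<s\le1$ and let $u\in\dot M^{s,\Phi}:=\dot M^{s,L^\Phi}(\mathcal P)$ be quasicontinuous (with respect to the $M^{s,L^\Phi}$-capacity). Then quasievery point is a generalized Lebesgue point of $u$. Moreover, if there exist constants $C_0\ge1$ and $\beta>Q/(Q+s)$ such that $$\Phi(\sigma)\le C_0(\sigma/t)^\beta\,\Phi(t)\quad\text{whenever } 0<\sigma\le t<\infty,$$ then quasievery point is a Lebesgue point of $u$.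
   Context: Space. $\mathcal P=(\mathcal P,d,\mu)$ is a metric space $(\mathcal P,d)$ with a Borel regular outer measure $\mu$ such that every ball $B(x,r)=\{y\in\mathcal P: d(y,x)<r\}$ ($r>0$) has positive and finite measure, and $\mu$ is doubling: there is a constant $c_d>0$ with $\mu(B(x,2r))\le c_d\,\mu(B(x,r))$ for all $x\in\mathcal P$, $r>0$. $L^0=L^0(\mathcal P)$ is the set of measurable, almost everywhere finite functions $u:\mathcal P\to[-\infty,\infty]$. Orlicz space. $L^\Phi=\{u\in L^0:\int_{\mathcal P}\Phi(|u|/\lambda)\,d\mu<\infty\text{ for some }\lambda>0\}$ with the quasinorm $\|u\|_{L^\Phi}=\inf\{\lambda>0:\int_{\mathcal P}\Phi(|u|/\lambda)\,d\mu\le1\}$. Hajłasz spaces (applied with $X=L^\Phi$). A measurable $g:\mathcal P\to[0,\infty]$ is an $s$-gradient of $u\in L^0$ if there is $E\subset\mathcal P$ with $\mu(E)=0$ such that $|u(x)-u(y)|\le d(x,y)^s(g(x)+g(y))$ for all $x,y\in\mathcal P\setminus E$. $\mathcal D^s(u)$ is the set of all $s$-gradients of $u$. $\dot M^{s,X}$ consists of measurable $u$ with $\|u\|_{\dot M^{s,X}}=\inf_{g\in\mathcal D^s(u)}\|g\|_X<\infty$; $M^{s,X}=\dot M^{s,X}\cap X$ with $\|u\|_{M^{s,X}}=\|u\|_X+\|u\|_{\dot M^{s,X}}$. Capacity. $C_{M^{s,X}}(E)=\inf\{\|u\|_{M^{s,X}}: u\in M^{s,X},\ u\ge1 \text{ on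 a neighbourhood of } E\}$. A property holds for quasievery point (quasieverywhere) if it holds outside a set of $M^{s,X}$-capacity zero. A function $u:\mathcal P\to[-\infty,\infty]$ is quasicontinuous if for every $\varepsilon>0$ there is $E\subset\mathcal P$ with $C_{M^{s,X}}(E)<\varepsilon$ such that the restriction of $u$ to $\mathcal P\setminus E$ is continuous. Medians and Lebesgue points. For $0<\gamma<1$, measurable $u$ and a set $A$ of finite measure, $m_u^\gamma(A)=\inf\{a\in\mathbb R:\mu(\{x\in A:u(x)>a\})<\gamma\mu(A)\}$. A point $x$ is a Lebesgue point of $u$ if $\lim_{r\to0}\frac1{\mu(B(x,r))}\int_{B(x,r)}u\,d\mu=u(x)$. It is a generalized Lebesgue point of $u$ if $\lim_{r\to0}m^\gamma_{|u-u(x)|}(B(x,r))=0$ and $\lim_{r\to0}m^\gamma_u(B(x,r))=u(x)$ for every $0<\gamma<1$. *)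

(* Defs.v *)
From HB Require Import structures.
From mathcomp Require Import all_boot all_order all_algebra.
From mathcomp Require Import all_classical all_reals all_analysis measurable_realfun.

Set Implicit Arguments.
Unset Strict Implicit.
Unset Printing Implicit Defensive.

Import Order.TTheory GRing.Theory Num.Theory.
Import numFieldNormedType.Exports.

Local Open Scope classical_set_scope.
Local Open Scope ring_scope.
Local Open Scope ereal_scope.

(* Nonempty metric spaces: the Caratheodory sigma-algebra of an outer measure
   is only available on pointed types. *)
#[short(type="pmetricType")]
HB.structure Definition PointedMetric (R : numDomainType) :=
  { T of Pointed T & Metric R T }.

Section metric_measure.
Context {R : realType} {T : pmetricType R}.
Variable mu : {outer_measure set T -> \bar R}.

(* The restriction of mu to its Caratheodory measurable sets; measurability and
   integrals below refer to this (complete) measure, while mu itself is applied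
   to arbitrary sets. *)
Definition cara_measure : {measure set (caratheodory_type mu) -> \bar R} := mu.

Definition borel_set : set (set T) := <<s [set U : set T | open U] >>.

Definition borel_regular : Prop :=
  (forall B, borel_set B -> mu.-caratheodory B) /\
  (forall A, exists B, [/\ borel_set B, A `<=` B & mu B = mu A]).

Definition balls_pos_finite : Prop :=
  forall (x : T) (r : R), (0 < r)%R -> 0 < mu (ball x r) < +oo.

Definition doubling_measure : Prop :=
  exists2 cd : R, (0 < cd)%R &
    forall (x : T) (r : R), (0 < r)%R ->
      mu (ball x (2 * r)%R) <= cd%:E * mu (ball x r).

Definition measurable_ereal (u : T -> \bar R) : Prop :=
  measurable_fun setT (u : caratheodory_type mu -> \bar R).

Definition L0 : set (T -> \bar R) :=
  [set u | measurable_ereal u /\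
           {ae cara_measure, forall x, u x \is a fin_num}].

(* Phi extended by Phi(+oo) = +oo. This matters only for functions that are
   infinite on a set of positive measure; these are not in L0, and the extension
   gives them the quasinorm +oo. *)
Definition Phi_ext (Phi : R -> R) (t : \bar R) : \bar R :=
  if t is a%:E then (Phi a)%:E else +oo.

Definition orlicz_modular (Phi : R -> R) (u : T -> \bar R) (l : R) : \bar R :=
  \int[cara_measure]_x Phi_ext Phi (`|u x| / l%:E).

Definition orlicz_space (Phi : R -> R) : set (T -> \bar R) :=
  [set u | L0 u /\ exists2 l : R, (0 < l)%R & orlicz_modular Phi u l < +oo].

Definition orlicz_norm (Phi : R -> R) (u : T -> \bar R) : \bar R :=
  ereal_inf [set l%:E | l in [set l : R | (0 < l)%R /\
                                          orlicz_modular Phi u l <= 1]].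

Definition s_gradient (s : R) (u g : T -> \bar R) : Prop :=
  [/\ measurable_ereal g, forall x, 0 <= g x &
      exists2 E : set T, mu E = 0 &
        forall x y, ~ E x -> ~ E y ->
          `|u x - u y| <= (mdist x y `^ s)%:E * (g x + g y)].

(* m_u^gamma(A) *)
Definition median (gamma : R) (u : T -> \bar R) (A : set T) : \bar R :=
  ereal_inf [set a%:E | a in [set a : R |
    mu [set x | A x /\ a%:E < u x] < gamma%:E * mu A]].

(* The averages in the definition of a Lebesgue point presuppose that u is
   integrable on small balls centred at x; without this requirement the library
   integral would take a conventional value. *)
Definition lebesgue_point (u : T -> \bar R) (x : T) : Prop :=
  (\forall r \near (0%R : R)^'+, cara_measure.-integrable (ball x r) u) /\
  (\int[cara_measure]_(y in ball x r) u y) / mu (ball x r)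
    @[r --> (0%R : R)^'+] --> u x.

Definition generalized_lebesgue_point (u : T -> \bar R) (x : T) : Prop :=
  forall gamma : R, (0 < gamma < 1)%R ->
    median gamma (fun y => `|u y - u x|) (ball x r)
      @[r --> (0%R : R)^'+] --> 0 /\
    median gamma u (ball x r) @[r --> (0%R : R)^'+] --> u x.

(* Hajlasz spaces and capacity over a function space X; the quasinorm N is
   defined on all functions, with value +oo on measurable functions not in X. *)
Section hajlasz.
Variables (s : R) (X : set (T -> \bar R)) (N : (T -> \bar R) -> \bar R).

Definition dotM_norm (u : T -> \bar R) : \bar R :=
  ereal_inf [set N g | g in s_gradient s u].

Definition dotM : set (T -> \bar R) := [set u | L0 u /\ dotM_norm u < +oo].

Definition M_space : set (T -> \bar R) := dotM `&` X.

Definition M_norm (u : T -> \bar R) : \bar R := N u + dotM_norm u.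

Definition capacity (E : set T) : \bar R :=
  ereal_inf [set M_norm v | v in [set v | M_space v /\
    exists U : set T, [/\ open U, E `<=` U & forall x, U x -> 1 <= v x]]].

Definition quasieverywhere (P : T -> Prop) : Prop :=
  exists2 E : set T, capacity E = 0 & forall x, ~ E x -> P x.

Definition quasicontinuous (u : T -> \bar R) : Prop :=
  forall e : R, (0 < e)%R ->
    exists2 E : set T, capacity E < e%:E & {within ~` E, continuous u}.

End hajlasz.

End metric_measure.

(* Main.v *)
Require Import Defs.
From mathcomp Require Import all_boot all_order all_algebra.
From mathcomp Require Import all_classical all_reals all_analysis measurable_realfun.
From mathcomp Require Import ring lra.
Import Order.TTheory GRing.Theory Num.Theory.
Import numFieldNormedType.Exports.
Local Open Scope classical_set_scope.
Local Open Scope ring_scope.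

(** Why the theorem holds.

    Capacity through energy. Let the energy of a function h be the integral of
    Phi (h). The growth of Phi makes a small quasinorm and a small energy
    equivalent, so a set is negligible for the capacity as soon as, for every
    d > 0, there are 0 <= v <= 1, equal to 1 on an open set containing it, and a
    gradient h >= v of v of energy at most d ([small], [small_of_capacity],
    [capacity_eq0]). Suprema of such pairs (v, h) are again such pairs, and the
    energy of a supremum is controlled by the sum of the energies
    ([small_bigcup]); this stands in for the missing triangle inequality.

    Generalized Lebesgue points. Outside a set E of small capacity, u is
    continuous relative to the complement of E. If x is not in E and E has small
    density in all small balls around x, then the medians of u over these balls
    converge to u x, whatever u does on E
    ([generalized_lebesgue_of_quasi_regular]). It remains to bound the capacity
    of the points around which E is dense at some scale r <= 1
    ([small_density]). Let (v, h) be a pair for E and let {v = 1} have a fixed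
    density in B (x, r). Either h >= r^-s / 12 on {v = 1} in B (x, r), or, since
    h is a gradient of v, h >= r^-s / 12 wherever v < 1/2 in B (x, 2 r). In the
    first case the energy of h in B (x, r) dominates that of a cutoff function of
    the ball, and Vitali's lemma allows the balls to be summed
    ([small_bigcup_balls]). In the second case the maximum of min (1, 2 v) and of
    all the cutoff functions has the gradient 12 h, however the balls overlap
    ([small_bigcup_cutoffs]). The same estimate, for truncations of |u|, shows
    that u is finite outside a negligible set ([infinite_negligible]).

    Lebesgue points. Let g be a gradient of u of finite energy and l > 0. By the
    covering argument again, outside a negligible set the average of Phi (g) over
    B (x, r) is at most Phi (l r^-s) for all small r
    ([energy_concentration_negligible]). The power growth of Phi then bounds the
    proportion of the ball where g > A l r^-s 2^k by a multiple of 2^(-k beta).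
    By the lower mass bound a point where g <= A l r^-s 2^k has, at distance
    comparable to r theta^k with theta = 2^(- beta / Q), a point where
    g <= A l r^-s 2^(k-1); between the two, u changes by at most a multiple of
    l (2 theta^s)^k. Summing along the chain and integrating
    ([chain_bound], [chain_integral]) bounds the mean oscillation of u by a
    multiple of l. The geometric series that arises has ratio
    2 theta^s 2^(- beta) = 2^(1 - beta (Q + s) / Q), which is less than 1 exactly
    when beta > Q / (Q + s). Finally l is arbitrary.

    If Phi vanishes identically, every set has capacity zero
    ([capacity_of_zero_growth]). *)

(** * Growth functions *)

(** The hypotheses on Phi in normalized form. They hold, with suitable constants,
    for every Phi of the theorem that does not vanish identically; the lower
    bounds on the constants remove case distinctions later on. *)
Record growth_function (R : realType) (Phi : R -> R) (C K : R) : Prop :=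
  GrowthFunction {
  growth_zero : Phi 0 = 0;
  growth_pos : forall t : R, 0 < t -> 0 < Phi t;
  growth_mono : forall x y : R, 0 <= x -> x <= y -> Phi x <= Phi y;
  growth_const_ge1 : 1 <= C;
  growth_double : forall t : R, 0 <= t -> Phi (2 * t) <= C * Phi t;
  growth_factor_ge2 : 2 <= K;
  growth_half : forall t : R, 0 <= t -> Phi t <= Phi (K * t) / 2 }.

Lemma archi_lt {R : realType} (a : R) : exists n : nat, a < n%:R.
Proof.
exists (Num.bound `|a|); apply: le_lt_trans (ler_norm _) _.
exact: archi_boundP.
Qed.

Lemma natr_le_exp2 {R : realType} (n : nat) : n%:R <= 2 ^+ n :> R.
Proof. by rewrite -natrX ler_nat ltnW// ltn_expl. Qed.

Section growth_function_theory.
Context {R : realType} {Phi : R -> R} {C K : R} (G : growth_function R Phi C K).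
Implicit Types (t : R) (a b : \bar R).

Let phi0 := growth_zero _ _ _ _ G.
Let phip := growth_pos _ _ _ _ G.
Let phim := growth_mono _ _ _ _ G.
Let C1 := growth_const_ge1 _ _ _ _ G.
Let dbl := growth_double _ _ _ _ G.
Let K2 := growth_factor_ge2 _ _ _ _ G.
Let half := growth_half _ _ _ _ G.
Let C0 : 0 <= C. Proof. exact: le_trans C1. Qed.
Let K0 : 0 <= K. Proof. exact: le_trans K2. Qed.

Lemma growth_ge0 t : 0 <= t -> 0 <= Phi t.
Proof. by move=> t0; rewrite -phi0; exact: phim. Qed.

Lemma growth_scale (A : R) : 0 <= A ->
  exists2 D : R, 1 <= D & forall t : R, 0 <= t -> Phi (A * t) <= D * Phi t.
Proof.
move=> A0; have [n An] := archi_lt A.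
have {An} An : A <= 2 ^+ n by rewrite (le_trans (ltW An))// natr_le_exp2.
have S m t : 0 <= t -> Phi (2 ^+ m * t) <= C ^+ m * Phi t.
  move=> t0; elim: m => [|m IH]; first by rewrite !expr0 !mul1r.
  rewrite !exprS -!mulrA (le_trans (dbl _ _)) ?mulr_ge0 ?exprn_ge0//.
  by rewrite ler_wpM2l.
exists (C ^+ n) => [|t t0]; first exact: exprn_ege1.
by apply: le_trans (S _ _ t0); apply: phim; rewrite ?mulr_ge0// ler_wpM2r.
Qed.

Lemma growth_half_iter k t : 0 <= t -> 2 ^+ k * Phi t <= Phi (K ^+ k * t).
Proof.
move=> t0; elim: k => [|k IH]; first by rewrite !expr0 !mul1r.
rewrite !exprS -!mulrA.
have /half := mulr_ge0 (exprn_ge0 k K0) t0.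
by rewrite ler_pdivlMr// mulrC; apply: le_trans; rewrite ler_pM2l.
Qed.

Lemma growth_unbounded (M : R) : exists2 t : R, 0 < t & M <= Phi t.
Proof.
have [n Mn] := archi_lt (M / Phi 1).
have p1 : 0 < Phi 1 by exact: phip.
have K0' : 0 < K by exact: lt_le_trans K2.
exists (K ^+ n * 1); first by rewrite mulr1 exprn_gt0.
apply: le_trans (growth_half_iter _ _ ler01).
rewrite -ler_pdivrMr//; apply: (le_trans (ltW Mn)); exact: natr_le_exp2.
Qed.

Lemma Phi_ext_ge0 a : (0 <= a)%E -> (0 <= Phi_ext Phi a)%E.
Proof. by case: a => //= t; rewrite !lee_fin; exact: growth_ge0. Qed.

Lemma Phi_ext0 : Phi_ext Phi 0 = 0%E.
Proof. by rewrite /= phi0. Qed.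

Lemma le_Phi_ext a b : (0 <= a)%E -> (a <= b)%E ->
  (Phi_ext Phi a <= Phi_ext Phi b)%E.
Proof.
case: a => [x| |]//; case: b => [y| |]//= x0 xy; last by rewrite leey.
by rewrite lee_fin phim.
Qed.

Lemma Phi_ext_scale (A : R) : 0 < A ->
  exists2 D : R, 1 <= D & forall a, (0 <= a)%E ->
    (Phi_ext Phi (A%:E * a) <= D%:E * Phi_ext Phi a)%E.
Proof.
move=> A0; have [D D1 HD] := growth_scale _ (ltW A0).
exists D => // -[t| |]//= t0; first by rewrite -EFinM !lee_fin HD.
by rewrite !gt0_muley// lte_fin (lt_le_trans _ D1).
Qed.

Lemma Phi_ext_max a b : (0 <= a)%E -> (0 <= b)%E ->
  (Phi_ext Phi (maxe a b) <= Phi_ext Phi a + Phi_ext Phi b)%E.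
Proof.
move=> a0 b0; rewrite maxEle; case: ifPn => _.
  by rewrite leeDr// Phi_ext_ge0.
by rewrite leeDl// Phi_ext_ge0.
Qed.

(** Doubling alone suffices: unless all values vanish, some h n exceeds half of
    the supremum (or, if the supremum is infinite, any given bound). *)
Lemma Phi_ext_esup (h : nat -> \bar R) : (forall n, 0 <= h n)%E ->
  (Phi_ext Phi (ereal_sup (range h)) <=
   C%:E * \sum_(0 <= n <oo) Phi_ext Phi (h n))%E.
Proof.
move=> h0; set S := ereal_sup _.
have p0 n : (0 <= Phi_ext Phi (h n))%E by exact: Phi_ext_ge0.
have term n : (Phi_ext Phi (h n) <= \sum_(0 <= n <oo) Phi_ext Phi (h n))%E.
  apply: le_trans (nneseries_lim_ge n.+1 _) => //.
  by rewrite big_nat_recr//= leeDr// sume_ge0.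
have s0 : (0 <= \sum_(0 <= n <oo) Phi_ext Phi (h n))%E by rewrite nneseries_ge0.
have S0 : (0 <= S)%E.
  by apply: le_trans (h0 0%N) (ereal_sup_ubound _); exists 0%N.
have pd t n : 0 <= t -> ((t / 2)%:E < h n)%E -> (Phi_ext Phi t%:E <=
    C%:E * \sum_(0 <= n <oo) Phi_ext Phi (h n))%E.
  move=> t0 xh; have x0 : 0 <= t / 2 by rewrite divr_ge0.
  apply: (@le_trans _ _ (C%:E * Phi_ext Phi (t / 2)%:E)%E).
    by rewrite /= lee_fin -[in leLHS](divfK (_ : 2 != 0) t)// mulrC dbl.
  rewrite lee_wpmul2l ?lee_fin//; apply: le_trans (term n).
  by apply: le_Phi_ext; rewrite ?lee_fin// ltW.
case ES : S => [t| |]; [ | | by rewrite ES in S0].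
- have : (0 <= t) by rewrite -lee_fin -ES.
  rewrite le_eqVlt => /predU1P[<-|t0]; first by rewrite Phi_ext0 mule_ge0.
  have : ((t / 2)%:E < S)%E by rewrite ES lte_fin; lra.
  by move=> /ereal_sup_gt[_ [n _ <-]] /pd; apply; exact: ltW.
- rewrite leye_eq; apply/eqP/eqyP => M M0.
  have [t t0 Mt] := growth_unbounded M.
  have : ((t / 2)%:E < S)%E by rewrite ES ltry.
  move=> /ereal_sup_gt[_ [n _ <-]] /(pd _ _ (ltW t0)).
  by apply: le_trans; rewrite lee_fin.
Qed.

Lemma measurable_Phi_ext d (T : measurableType d) (h : T -> \bar R) :
  (forall x, 0 <= h x)%E -> measurable_fun setT h ->
  measurable_fun setT (Phi_ext Phi \o h).
Proof.
move=> h0 mh; pose Psi (t : R) : R := Phi (Num.max t 0).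
rewrite (_ : Phi_ext Phi \o h = er_map Psi \o h); last first.
  apply/funext => x /=; move: (h0 x); case: (h x) => //= t.
  by rewrite lee_fin /Psi => /max_idPl->.
apply: measurableT_comp => //; apply: (measurable_er_map T).
apply: nondecreasing_measurable => // x y xy; rewrite /Psi.
apply: phim; first by rewrite le_max lexx orbT.
by rewrite ge_max !le_max xy lexx orbT.
Qed.

End growth_function_theory.

(** * Metric balls, cutoff functions and measurability *)

Section power_lemmas.
Context {R : realType}.
Implicit Types s t r d : R.

Lemma powRN_ge1 s r : 0 < s -> 0 < r -> r <= 1 -> 1 <= r `^ (- s).
Proof.
move=> s0 r0 r1; rewrite powRN -[leLHS]invr1 lef_pV2 ?posrE ?powR_gt0//.
have : r `^ s <= 1 `^ s by rewrite ge0_ler_powR// ?nnegrE ltW.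
by rewrite powR1.
Qed.

Lemma minr1_le_powR s t : 0 < s -> s <= 1 -> 0 <= t -> Num.min 1 t <= t `^ s.
Proof.
move=> s0 s1 t0; rewrite ge_min; have [t1|t1] := leP 1 t.
  rewrite -[in X in X || _](powRr0 t) ler_powR//; exact: ltW.
move: t0; rewrite le_eqVlt => /predU1P[<-|t0].
  by rewrite powR_ge0 orbT.
by rewrite -[X in _ || (X <= _)]powRr1 ?(ltW t0)// ger_powR ?orbT// t0 ltW.
Qed.

Lemma powR_div s d r : 0 <= d -> 0 < r -> (d / r) `^ s = d `^ s * r `^ (- s).
Proof.
move=> d0 r0; rewrite powRM ?invr_ge0 ?(ltW r0)//.
by rewrite -powR_inv1 ?(ltW r0)// -powRrM mulN1r.
Qed.

End power_lemmas.

Section metric_measure.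
Context {R : realType} {T : pmetricType R}.
Implicit Types (x y z : T) (r a : R).

Lemma mem_ball x r y : ball x r y = (mdist x y < r) :> Prop.
Proof. by rewrite ballEmdist. Qed.

Lemma mem_ball_center x r : 0 < r -> ball x r x.
Proof. by rewrite mem_ball mdistxx. Qed.

Lemma sub_ball x r y r' : mdist x y + r' <= r -> ball y r' `<=` ball x r.
Proof.
move=> h z; rewrite !mem_ball => yz.
by rewrite (le_lt_trans (metric_triangle x y z))// (lt_le_trans _ h)// ltrD2l.
Qed.

Lemma open_metric_ball x r : open (ball x r).
Proof.
rewrite openE => y; rewrite mem_ball => xy.
apply/nbhs_ballP; exists (r - mdist x y) => /=; first by rewrite subr_gt0.
by apply: sub_ball; rewrite addrC subrK.
Qed.

Definition cutoff x r y : R := Num.max 0 (Num.min 1 (2 - mdist x y / r)).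

Lemma cutoff_ge0 x r y : 0 <= cutoff x r y.
Proof. by rewrite /cutoff le_max lexx. Qed.

Lemma cutoff_le1 x r y : cutoff x r y <= 1.
Proof. by rewrite /cutoff ge_max ler01 ge_min lexx. Qed.

Lemma cutoff1 x r y : 0 < r -> ball x r y -> cutoff x r y = 1.
Proof.
rewrite mem_ball => r0 xy; apply/eqP; rewrite eq_le cutoff_le1/= le_max le_min.
have : mdist x y / r <= 1 by rewrite ler_pdivrMr// mul1r ltW.
by rewrite lexx/= => h; apply/orP; right; lra.
Qed.

Lemma cutoff_gt x r y a : 0 < r -> 0 <= a ->
  (a < cutoff x r y) = (a < 1) && (mdist x y < (2 - a) * r).
Proof.
move=> r0 a0; rewrite lt_max lt_min ltNge a0/=; congr (_ && _).
by rewrite -ltr_pdivrMr// ltrBrDr addrC -ltrBrDr.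
Qed.

Lemma cutoff_supp x r y : 0 < r -> 0 < cutoff x r y -> ball x (2 * r) y.
Proof. by move=> r0; rewrite cutoff_gt// mem_ball subr0 => /andP[]. Qed.

(** The cutoff is Lipschitz with constant 1 / r and has oscillation at most 1, so
    it is Hoelder continuous with exponent s and constant r^-s. *)
Lemma cutoff_holder s x r y z : 0 < s -> s <= 1 -> 0 < r ->
  cutoff x r y <= cutoff x r z + mdist y z `^ s * r `^ (- s).
Proof.
move=> s0 s1 r0; rewrite -powR_div ?mdist_ge0//.
have d0 : 0 <= mdist y z / r by rewrite divr_ge0 ?mdist_ge0// ltW.
have := minr1_le_powR s _ s0 s1 d0.
set p := _ `^ _; move=> hp.
have tri : 2 - mdist x y / r <= 2 - mdist x z / r + mdist y z / r.
  have : mdist x z / r <= mdist x y / r + mdist y z / r.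
    by rewrite -mulrDl ler_pM2r ?invr_gt0// metric_triangle.
  by lra.
have p0 : 0 <= p by rewrite powR_ge0.
have [p1|p1] := leP 1 p.
  by rewrite (le_trans (cutoff_le1 _ _ _))// (le_trans p1)// lerDr cutoff_ge0.
have {hp} dp : mdist y z / r <= p.
  by move: hp; rewrite ge_min leNgt p1.
rewrite /cutoff; set A := 2 - _ in tri *; set B := 2 - _ in tri *.
rewrite ge_max addr_ge0 ?le_max ?lexx//= addr_maxl le_max; apply/orP; right.
rewrite addr_minl le_min ge_min lerDl p0/= ge_min; apply/orP; right.
by rewrite (le_trans tri)// lerD2l.
Qed.

Context (mu : {outer_measure set T -> \bar R}).
Notation cmu := (cara_measure mu).
Notation cT := (caratheodory_type mu).
Hypothesis (mu_regular : borel_regular mu).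

Lemma open_cara (U : set T) : open U -> measurable (U : set cT).
Proof.
by move=> oU; apply: mu_regular.1; exact: sub_sigma_algebra.
Qed.

Lemma measurable_metric_ball x r : measurable (ball x r : set cT).
Proof. exact/open_cara/open_metric_ball. Qed.

Lemma null_cara (E : set T) : mu E = 0%E -> measurable (E : set cT).
Proof.
move=> E0; apply: (measure_is_complete_caratheodory (mu := mu)).
have [_ /(_ E)[B [BB EB muB]]] := mu_regular.
by exists B; split => //; [exact: mu_regular.1|rewrite /= muB].
Qed.

Lemma measurable_fun_gt (f : cT -> R) :
  (forall a, measurable [set x | a < f x]) -> measurable_fun setT f.
Proof.
move=> H; apply: (measurability _ (RGenOInfty.measurableE R)) => //.
move=> /= _ [_ [a ->] <-]; rewrite setTI (_ : _ @^-1` _ = [set x | a < f x])//.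
by apply/seteqP; split => x /=; rewrite in_itv/= andbT.
Qed.

(** A supremum of cutoffs, even of uncountably many, is lower semicontinuous. *)
Lemma measurable_sup_cutoff (F : set (T * R)) : (forall p, F p -> 0 < p.2) ->
  measurable_fun setT
    ((fun y => sup [set cutoff p.1 p.2 y | p in F]) : cT -> R).
Proof.
move=> F0; apply: measurable_fun_gt => a.
have ub y : has_ubound [set cutoff p.1 p.2 y | p in F].
  by exists 1 => _ [p _ <-]; exact: cutoff_le1.
have sge0 y : 0 <= sup [set cutoff p.1 p.2 y | p in F].
  have [->|/set0P[p Fp]] := eqVneq F set0; first by rewrite image_set0 sup0.
  apply: le_trans (cutoff_ge0 p.1 p.2 y) _; apply: ub_le_sup => //.
  by exists p.
have [a0|a0] := ltP a 0.
  rewrite (_ : [set _ | _] = setT)//; apply/seteqP; split => // y _ /=.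
  exact: lt_le_trans (sge0 y).
rewrite (_ : [set _ | _] = \bigcup_(p in F)
    [set y | (a < 1) && (mdist p.1 y < (2 - a) * p.2)]).
  apply: open_cara; apply: bigcup_open => p Fp.
  have [a1|a1] := ltP a 1; last first.
    by rewrite (_ : [set _ | _] = set0); [exact: open0|apply/seteqP; split].
  rewrite (_ : [set _ | _] = ball p.1 ((2 - a) * p.2)); last first.
    by rewrite ballEmdist.
  exact: open_metric_ball.
apply/seteqP; split => y /=.
  move=> asup; have [|b [p Fp <-] ab] := sup_gt _ asup.
    have [F_0|/set0P//] := eqVneq F set0.
      by move: asup; rewrite F_0 image_set0 sup0 ltNge a0.
    by move=> [p Fp]; exists (cutoff p.1 p.2 y), p.
  by exists p => //=; rewrite -cutoff_gt// F0.
move=> [p Fp /=]; rewrite -cutoff_gt ?F0// => /lt_le_trans; apply.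
by apply: ub_le_sup => //; exists p.
Qed.

Lemma measurable_cutoff x r : 0 < r -> measurable_fun setT (cutoff x r : cT -> R).
Proof.
move=> r0; have := @measurable_sup_cutoff [set (x, r)].
rewrite (_ : (fun y => _) = cutoff x r).
  by apply => p -> .
by apply/funext => y; rewrite image_set1 sup1.
Qed.

End metric_measure.

Section doubling.
Local Open Scope ereal_scope.
Context {R : realType} {T : pmetricType R} {mu : {outer_measure set T -> \bar R}}.
Hypothesis (mu_doubling : doubling_measure mu).

(** One dilation factor that covers all the enlargements of balls used below. *)
Lemma doubling_ball : exists2 D : R, (1 <= D)%R & forall (x : T) (r : R),
  (0 < r)%R -> mu (ball x (16 * r)%R) <= D%:E * mu (ball x r).
Proof.
have [cd cd0 H] := mu_doubling.
exists (Num.max 1 (cd ^+ 4))%R; first by rewrite le_max lexx.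
move=> x r r0.
have S n : mu (ball x (2 ^+ n * r)%R) <= (cd ^+ n)%:E * mu (ball x r).
  elim: n => [|n IH]; first by rewrite !expr0 mul1r mul1e.
  rewrite exprS -mulrA (le_trans (H _ _ _)) ?mulr_gt0 ?exprn_gt0//.
  by rewrite exprS EFinM -muleA lee_pmul2l.
have -> : (16 * r = 2 ^+ 4 * r)%R by congr (_ * _)%R; ring.
apply: (le_trans (S 4%N)); apply: lee_wpmul2r; first exact: outer_measure_ge0.
by rewrite lee_fin le_max lexx orbT.
Qed.

End doubling.

(** * Vitali's covering lemma *)

Section vitali.
Context {R : realType} {T : pmetricType R}.
Notation B p := (ball p.1 p.2).

(** Zorn's lemma applies to the disjoint subfamilies D such that every ball of F
    that meets D meets a ball of D of at least half its radius. If a ball of F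
    missed a maximal such D, then a ball of nearly maximal radius among those that
    miss D could be added to it. *)
Lemma vitali_disjoint_subfamily (F : set (T * R)) (M : R) :
  (forall p, F p -> 0 < p.2 <= M) ->
  exists D : set (T * R), [/\ D `<=` F,
    trivIset D (fun p => B p) &
    forall p, F p -> exists2 q, D q & B p `<=` ball q.1 (5 * q.2)].
Proof.
move=> F0.
pose meets (A : set (T * R)) p := exists2 q, A q & B p `&` B q !=set0.
pose P (A : set (T * R)) := [/\ A `<=` F, trivIset A (fun p => B p) &
  forall p, F p -> meets A p ->
    exists q, [/\ A q, B p `&` B q !=set0 & p.2 <= 2 * q.2]].
have [|A [[AF tA HA] maxA]] := @Zorn_bigcup _ P.
  move=> Q QP Qtot; split.
  - by move=> p [X QX Xp]; have [XF _ _] := QP _ QX; exact: XF.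
  - move=> p q [X QX Xp] [Y QY Yq].
    have [XY|YX] := Qtot _ _ QX QY.
      by have [_ tY _] := QP _ QY; exact: tY (XY _ Xp) Yq.
    by have [_ tX _] := QP _ QX; exact: tX Xp (YX _ Yq).
  - move=> p Fp [q [X QX Xq] pq]; have [_ _ HX] := QP _ QX.
    have [|q' [Xq' ? ?]] := HX _ Fp; first by exists q.
    by exists q'; split => //; exists X.
have cov p : F p -> meets A p.
  move=> Fp; apply: contrapT => nAp.
  pose N := [set q | F q /\ ~ meets A q].
  have Nsup : has_sup [set q.2 | q in N].
    split; first by exists p.2, p.
    by exists M => _ [q [Fq _] <-]; have /andP[] := F0 _ Fq.
  have p0 : 0 < sup [set q.2 | q in N].
    have /andP[p0 _] := F0 _ Fp; apply: (lt_le_trans p0).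
    by apply: ub_le_sup; [exact: Nsup.2|exists p].
  have [|_ [q [Fq nAq] <-] qlt] :=
      @sup_gt _ [set q.2 | q in N] (sup [set q.2 | q in N] / 2) Nsup.1.
    by rewrite ltr_pdivrMr// ltr_pMr// ltr1n.
  have q0 : 0 < q.2 by have /andP[] := F0 _ Fq.
  have qself : B q `&` B q !=set0.
    by exists q.1; rewrite setIid; exact: mem_ball_center.
  have nAq' : ~ A q by move=> Aq; apply: nAq; exists q.
  apply: (maxA (q |` A)).
    split=> [x Ax|/(_ q (or_introl erefl))//]; by right.
  split.
  - by move=> x [->//|/AF].
  - move=> x y [->|Ax] [->|Ay]//; last exact: tA.
      by move=> xy; exfalso; apply: nAq; exists y.
    by rewrite setIC => xy; exfalso; apply: nAq; exists x.
  - move=> x Fx [y yA xy].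
    have [mAx|nAx] := pselect (meets A x).
      by have [z [Az xz xz2]] := HA _ Fx mAx; exists z; split => //; right.
    have {yA} yq : y = q by case: yA => // Ay; exfalso; apply: nAx; exists y.
    exists q; split; [by left|by rewrite -yq|].
    have : x.2 <= sup [set q.2 | q in N].
      by apply: ub_le_sup; [exact: Nsup.2|exists x].
    rewrite ltr_pdivrMr// in qlt.
    by move=> /le_lt_trans /(_ qlt) /ltW; rewrite mulrC.
exists A; split => // p Fp.
have [q [Aq [z [pz qz]] pq]] := HA _ Fp (cov _ Fp); exists q => //.
move: pz qz; rewrite !mem_ball => pz qz; apply: sub_ball.
have := metric_triangle q.1 z p.1; rewrite (metric_sym z).
by move: pz qz pq; lra.
Qed.

End vitali.

(** For each n, only finitely many of the disjoint sets carry an integral larger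
    than 1 / (n + 1). *)
Lemma trivIset_integral_countable d (X : measurableType d) (R : realType)
    (nu : {measure set X -> \bar R}) (I : pointedType) (D : set I) (B : I -> set X)
    (f : X -> \bar R) :
  (forall i, D i -> measurable (B i)) -> trivIset D B ->
  measurable_fun setT f -> (forall x, 0 <= f x)%E ->
  (\int[nu]_x f x < +oo)%E ->
  (forall i, D i -> (0 < \int[nu]_(x in B i) f x)%E) -> countable D.
Proof.
move=> mB tB mf f0 foo pos.
pose J n := [set i | D i /\ ((n.+1%:R^-1)%:E < \int[nu]_(x in B i) f x)%E].
rewrite (_ : D = \bigcup_n J n); last first.
  apply/seteqP; split => [i Di|i [n _ []]//].
  have := pos _ Di; case E : (\int[nu]_(x in B i) f x)%E => [a| |]//.
    rewrite lte_fin => a0.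
    have [n] := ltr_add_invr a0; rewrite add0r => na.
    by exists n => //; split=> //; rewrite E lte_fin.
  by move=> _; exists 0%N => //; split=> //; rewrite E ltry.
apply: bigcup_countable => // n _; apply: finite_set_countable.
apply: contrapT => /infiniteP/pcard_leP/injfunPex[/= q q_fun q_inj].
have qD k : D (q k) by have [] := q_fun k Logic.I.
have int_ge m : ((m%:R / n.+1%:R)%:E <= \int[nu]_x f x)%E.
  apply: (@le_trans _ _ (\int[nu]_(x in \bigcup_k B (q k)) f x)%E); last first.
    apply: ge0_subset_integral => //.
    by apply: bigcup_measurable => k _; exact: mB.
  rewrite ge0_integral_bigcup//; first last.
  - move=> i j _ _ ij; apply: q_inj; rewrite ?inE//.
    by apply: tB ij.
  - exact: measurable_funS mf.
  - by move=> k; exact: mB.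
  apply: (le_trans _ (nneseries_lim_ge m _)) => [|k _ _]; last exact: integral_ge0.
  rewrite (_ : (_ / _)%:E = \sum_(0 <= k < m) (n.+1%:R^-1)%:E)%E.
    by apply: lee_sum => k _; have [_ /ltW] := q_fun k Logic.I.
  by rewrite sumEFin sumr_const_nat subn0 mulrC mulr_natr.
have f_fin : (\int[nu]_x f x)%E \is a fin_num.
  by rewrite ge0_fin_numE// integral_ge0.
have [m] := archi_lt (fine (\int[nu]_x f x)%E * n.+1%:R).
have := int_ge m; rewrite -(fineK f_fin) lee_fin ler_pdivrMr//.
by move=> /le_lt_trans h /h; rewrite ltxx.
Qed.

(** * Test pairs and small sets *)

Section test_functions.
Context {R : realType} {T : pmetricType R}.
Context (mu : {outer_measure set T -> \bar R}) (s : R) (Phi : R -> R).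
Notation cmu := (cara_measure mu).
Notation cT := (caratheodory_type mu).

(** A truncated competitor v for the capacity together with a gradient h that also
    dominates v, so that the energy of h alone controls both terms of the norm.
    The inequalities are required at all points: an exceptional null set is
    absorbed by h = +oo, and the formulation by real upper bounds of h makes them
    vacuous there. *)
Record test_pair (v : T -> R) (h : T -> \bar R) : Prop := TestPair {
  test_measurable : measurable_fun setT (v : cT -> R);
  test_grad_measurable : measurable_fun setT (h : cT -> \bar R);
  test_ge0 : forall x, 0 <= v x;
  test_le1 : forall x, v x <= 1;
  test_grad_ge0 : forall x, (0 <= h x)%E;
  test_le_grad : forall x (a : R), (h x <= a%:E)%E -> v x <= a;
  test_holder : forall x y (a b : R), (h x <= a%:E)%E -> (h y <= b%:E)%E ->
    v x <= v y + mdist x y `^ s * (a + b) }.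

Definition energy (h : T -> \bar R) : \bar R :=
  (\int[cmu]_x Phi_ext Phi (h x))%E.

Definition small (d : \bar R) (A : set T) : Prop :=
  exists U v h, [/\ open U, A `<=` U, test_pair v h,
    forall x, U x -> v x = 1 & (energy h <= d)%E].

Definition negligible_cap (A : set T) : Prop :=
  forall d : R, 0 < d -> small d%:E A.

Lemma small_le d d' A A' : (d <= d')%E -> A' `<=` A -> small d A -> small d' A'.
Proof.
move=> dd AA [U [v [h [oU AU vh v1 hd]]]]; exists U, v, h; split => //.
  exact: subset_trans AU.
exact: le_trans dd.
Qed.

Context {C K : R} (G : growth_function R Phi C K).

Lemma small_set0 : small 0 set0.
Proof.
exists set0, (cst 0), (cst 0%E); split => //; first exact: open0.
  split => //= x y a b; rewrite !lee_fin add0r => a0 b0.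
  by rewrite mulr_ge0 ?powR_ge0// addr_ge0.
rewrite /energy; under eq_integral do rewrite /cst (Phi_ext0 G).
by rewrite integral0.
Qed.

Lemma measurable_energy (h : T -> \bar R) : (forall x, (0 <= h x)%E) ->
  measurable_fun setT (h : cT -> \bar R) ->
  measurable_fun setT ((fun x => Phi_ext Phi (h x)) : cT -> \bar R).
Proof. move=> h0 mh; exact: (measurable_Phi_ext G). Qed.

(** The pointwise suprema of the functions v and of the gradients h form a test
    pair for the union. *)
Lemma small_bigcup (A : nat -> set T) (d : nat -> \bar R) :
  (forall n, small (d n) (A n)) ->
  small (C%:E * \sum_(0 <= n <oo) d n)%E (\bigcup_n A n).
Proof.
move=> sA; have /choice[X HX] : forall n,
   exists X : set T * (T -> R) * (T -> \bar R),
   [/\ open X.1.1, A n `<=` X.1.1, test_pair X.1.2 X.2,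
    forall x, X.1.1 x -> X.1.2 x = 1 & (energy X.2 <= d n)%E].
  by move=> n; have [U [v [h H]]] := sA n; exists (U, v, h).
pose U n := (X n).1.1; pose v n := (X n).1.2; pose h n := (X n).2.
have oU n : open (U n) by have [] := HX n.
have AU n : A n `<=` U n by have [] := HX n.
have vh n : test_pair (v n) (h n) by have [] := HX n.
have v1 n x : U n x -> v n x = 1 by have [_ _ _ H _] := HX n; exact: H.
have hd n : (energy (h n) <= d n)%E by have [] := HX n.
have ub x : has_ubound (range (v ^~ x)).
  by exists 1 => _ [n _ <-]; exact: test_le1 (vh n) x.
have v_le x n : v n x <= sup (range (v ^~ x)).
  by apply: ub_le_sup => //; exists n.
have ne x : range (v ^~ x) !=set0 by exists (v 0%N x), 0%N.
have h_le x n : (h n x <= ereal_sup (range (h ^~ x)))%E.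
  by apply: ereal_sup_ubound; exists n.
have h0 n x : (0 <= h n x)%E by exact: test_grad_ge0 (vh n) x.
have C0 : 0 <= C by exact: le_trans (growth_const_ge1 _ _ _ _ G).
have sdrop0 (V : Type) (w : nat -> V) : sdrop w 0 = range w.
  by apply/seteqP; split => y [n _ <-]; exists n.
have mv : measurable_fun setT ((fun x => sup (range (v ^~ x))) : cT -> R).
  have := @measurable_fun_sups _ cT R setT v 0%N.
  rewrite (_ : (fun x => sups _ _) = (fun x => sup (range (v ^~ x)))).
    by apply => // n; exact: test_measurable (vh n).
  by apply/funext => x; rewrite /sups /= sdrop0.
have mh : measurable_fun setT
    ((fun x => ereal_sup (range (h ^~ x))) : cT -> \bar R).
  have := @measurable_fun_esups _ cT R setT h _ 0%N.
  rewrite (_ : (fun x => esups _ _) = (fun x => ereal_sup (range (h ^~ x)))).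
    by apply => n; exact: test_grad_measurable (vh n).
  by apply/funext => x; rewrite /esups /= sdrop0.
exists (\bigcup_n U n), (fun x => sup (range (v ^~ x))),
  (fun x => ereal_sup (range (h ^~ x))); split.
- by apply: bigcup_open.
- by move=> x [n _ Ax]; exists n => //; exact: AU.
- split => //.
  + by move=> x; apply: le_trans (v_le x 0%N); exact: test_ge0 (vh _) x.
  + move=> x; apply: ge_sup => // _ [n _ <-]; exact: test_le1 (vh _) x.
  + by move=> x; apply: le_trans (h_le x 0%N).
  + move=> x a ha; apply: ge_sup => // _ [n _ <-].
    exact: test_le_grad (vh n) _ _ (le_trans (h_le _ _) ha).
  + move=> x y a b ha hb; apply: ge_sup => // _ [n _ <-].
    apply: le_trans (test_holder _ _ (vh n) x y a b _ _) _.
    * exact: le_trans (h_le _ _) ha.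
    * exact: le_trans (h_le _ _) hb.
    * by rewrite lerD2r.
- move=> x [n _ Ux]; apply/eqP; rewrite eq_le; apply/andP; split.
    by apply: ge_sup => // _ [m _ <-]; exact: test_le1 (vh _) x.
  by rewrite -(v1 _ _ Ux).
- have mP n : measurable_fun setT ((fun x => Phi_ext Phi (h n x)) : cT -> \bar R).
    by apply: measurable_energy => //; exact: test_grad_measurable (vh n).
  apply: (@le_trans _ _
      (\int[cmu]_x (C%:E * \sum_(0 <= n <oo) Phi_ext Phi (h n x)))%E).
    apply: ge0_le_integral => //.
    + by move=> x _; apply: Phi_ext_ge0 G _ _; apply: le_trans (h_le x 0%N).
    + by apply: measurable_energy => // x; apply: le_trans (h_le x 0%N).
    + apply: emeasurable_funM => //; apply: ge0_emeasurable_sum => // n x _ _.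
      exact: Phi_ext_ge0 G _ _.
    + by move=> x _; exact: (Phi_ext_esup G).
  have p0 n x : (0 <= Phi_ext Phi (h n x))%E by exact: Phi_ext_ge0 G _ _.
  rewrite ge0_integralZl_EFin//; last 2 first.
    by move=> x _; exact: nneseries_ge0.
    by apply: ge0_emeasurable_sum.
  apply: lee_wpmul2l; first by rewrite lee_fin.
  rewrite integral_nneseries//; apply: lee_nneseries => n _ //.
    by move=> _; apply: integral_ge0.
  exact: hd.
Qed.

End test_functions.

Section small_sets.
Context {R : realType} {T : pmetricType R}.
Context (mu : {outer_measure set T -> \bar R}) (s : R) (Phi : R -> R).
Context {C K : R} (G : growth_function R Phi C K).
Notation cmu := (cara_measure mu).
Notation cT := (caratheodory_type mu).
Notation small := (small mu s Phi).
Notation negligible_cap := (negligible_cap mu s Phi).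
Notation energy := (energy mu Phi).

Let C1 := growth_const_ge1 _ _ _ _ G.

Lemma energy_ge0 h : (forall x, 0 <= h x)%E -> (0 <= energy h)%E.
Proof. by move=> h0; apply: integral_ge0 => x _; exact: (Phi_ext_ge0 G). Qed.

Lemma le_energy h k : (forall x, 0 <= h x)%E ->
  measurable_fun setT (h : cT -> \bar R) ->
  measurable_fun setT (k : cT -> \bar R) ->
  (forall x, h x <= k x)%E -> (energy h <= energy k)%E.
Proof.
move=> h0 mh mk hk; have k0 x : (0 <= k x)%E by exact: le_trans (hk x).
apply: ge0_le_integral => //.
- by move=> x _; exact: (Phi_ext_ge0 G).
- exact: (measurable_energy mu Phi G).
- exact: (measurable_energy mu Phi G).
- by move=> x _; exact: (le_Phi_ext G).
Qed.

Lemma energy_max h k : (forall x, 0 <= h x)%E -> (forall x, 0 <= k x)%E ->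
  measurable_fun setT (h : cT -> \bar R) ->
  measurable_fun setT (k : cT -> \bar R) ->
  (energy (fun x => maxe (h x) (k x)) <= energy h + energy k)%E.
Proof.
move=> h0 k0 mh mk; rewrite /energy -ge0_integralD//.
- apply: ge0_le_integral => //.
  + by move=> x _; apply: (Phi_ext_ge0 G); rewrite le_max h0.
  + apply: (measurable_energy mu Phi G); last exact: measurable_maxe.
    by move=> x; rewrite le_max h0.
  + by apply: emeasurable_funD; exact: (measurable_energy mu Phi G).
  + by move=> x _; exact: (Phi_ext_max G).
- by move=> x _; exact: (Phi_ext_ge0 G).
- exact: (measurable_energy mu Phi G).
- by move=> x _; exact: (Phi_ext_ge0 G).
- exact: (measurable_energy mu Phi G).
Qed.

Lemma energy_scale (A : R) : 0 < A -> exists2 D : R, 1 <= D &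
  forall h, (forall x, 0 <= h x)%E -> measurable_fun setT (h : cT -> \bar R) ->
  (energy (fun x => A%:E * h x) <= D%:E * energy h)%E.
Proof.
move=> A0; have [D D1 HD] := Phi_ext_scale G _ A0.
exists D => // h h0 mh; rewrite /energy -ge0_integralZl_EFin//; last 3 first.
- by move=> x _; exact: (Phi_ext_ge0 G).
- exact: (measurable_energy mu Phi G).
- by rewrite (le_trans _ D1).
apply: ge0_le_integral => //.
- by move=> x _; apply: (Phi_ext_ge0 G); rewrite mule_ge0// lee_fin ltW.
- apply: (measurable_energy mu Phi G) => [x|]; last exact: emeasurable_funM.
  by rewrite mule_ge0// lee_fin ltW.
- by apply: emeasurable_funM => //; exact: (measurable_energy mu Phi G).
- by move=> x _; exact: HD.
Qed.

Lemma energy_half k h : (forall x, 0 <= h x)%E ->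
  measurable_fun setT (h : cT -> \bar R) ->
  ((2 ^+ k)%:E * energy h <= energy (fun x => (K ^+ k)%:E * h x))%E.
Proof.
have K0 : 0 < K by apply: lt_le_trans (growth_factor_ge2 _ _ _ _ G).
move=> h0 mh; rewrite /energy -ge0_integralZl_EFin//; last 2 first.
- by move=> x _; exact: (Phi_ext_ge0 G).
- exact: (measurable_energy mu Phi G).
apply: ge0_le_integral => //.
- by move=> x _; rewrite mule_ge0 ?lee_fin ?exprn_ge0//; exact: (Phi_ext_ge0 G).
- by apply: emeasurable_funM => //; exact: (measurable_energy mu Phi G).
- apply: (measurable_energy mu Phi G) => [x|]; last exact: emeasurable_funM.
  by rewrite mule_ge0// lee_fin ltW// exprn_gt0.
- move=> x _; move: (h0 x); case: (h x) => [t| |]//= t0.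
    by rewrite lee_fin (growth_half_iter G).
  by rewrite !gt0_muley ?leey// lte_fin ?exprn_gt0.
Qed.

Lemma small_ge0 d A : small d A -> (0 <= d)%E.
Proof.
move=> [U [v [h [_ _ vh _ hd]]]]; apply: le_trans hd; apply: energy_ge0.
exact: test_grad_ge0 vh.
Qed.

Lemma small_setU d d' A B : small d A -> small d' B ->
  small (C%:E * (d + d'))%E (A `|` B).
Proof.
move=> sA sB.
pose F n := match n with 0%N => A | 1%N => B | _ => set0 end.
pose D n : \bar R := match n with 0%N => d | 1%N => d' | _ => 0%E end.
have FD n : small (D n) (F n).
  by case: n => [|[|n]]//=; exact: (small_set0 mu s Phi G).
apply: small_le (small_bigcup mu s Phi G _ _ FD).
  rewrite (nneseries_split 0 2); last by move=> k _; exact: small_ge0 (FD k).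
  by rewrite eseries0 ?adde0; [rewrite !big_nat_recr//= big_nil add0e|case=> [|[]]].
by move=> x [Ax|Bx]; [exists 0%N|exists 1%N].
Qed.

Lemma negligible_cap_sub A B : A `<=` B -> negligible_cap B -> negligible_cap A.
Proof. by move=> AB nB d d0; apply: small_le (nB _ d0) => //. Qed.

Lemma negligible_cap_bigcup (A : nat -> set T) :
  (forall n, negligible_cap (A n)) -> negligible_cap (\bigcup_n A n).
Proof.
move=> nA d d0; have C0 : 0 < C by apply: lt_le_trans C1.
have dC0 : 0 < d / C by rewrite divr_gt0.
have FD n : small (d / C / (2 ^ n.+1)%:R)%:E (A n).
  by apply: nA; rewrite divr_gt0// ltr0n expn_gt0.
apply: small_le (small_bigcup mu s Phi G _ _ FD) => //.
have := epsilon_trick0 xpredT (ltW dC0).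
move=> /(lee_wpmul2l (_ : 0 <= C%:E)%E) => /(_ (ltW C0)) /le_trans; apply.
by rewrite -EFinM mulrC divfK// gt_eqF.
Qed.

Hypothesis (mu_regular : borel_regular mu).
Hypothesis (s_gt0 : 0 < s) (s_le1 : s <= 1).

(** The cutoff of B (x, 5 r) has the gradient r^-s on B (x, 10 r), which
    dominates the cutoff because r <= 1. *)
Lemma small_ball x r : 0 < r -> r <= 1 ->
  small ((Phi (r `^ (- s)))%:E * mu (ball x (10 * r))) (ball x (5 * r)).
Proof.
move=> r0 r1.
have mB : measurable (ball x (10 * r) : set cT).
  exact: (measurable_metric_ball mu mu_regular).
have p0 : 0 < r `^ (- s) by rewrite powR_gt0.
have p1 : 1 <= r `^ (- s) by exact: powRN_ge1.
have r5 : 0 < 5 * r by rewrite mulr_gt0.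
have supp y : 0 < cutoff x (5 * r) y -> ball x (10 * r) y.
  by move=> /(cutoff_supp _ _ _ r5); rewrite mulrA -natrM.
exists (ball x (5 * r)), (cutoff x (5 * r)),
  (fun y => (r `^ (- s) * \1_(ball x (10 * r)) y)%:E); split => //.
- exact: open_metric_ball.
- split.
  + exact: (measurable_cutoff mu mu_regular).
  + apply/measurable_EFinP; apply: measurable_funM => //.
  + by move=> y; exact: cutoff_ge0.
  + by move=> y; exact: cutoff_le1.
  + by move=> y; rewrite lee_fin mulr_ge0// ltW.
  + move=> y a; rewrite lee_fin; apply: le_trans.
    have [/supp By|] := ltP 0 (cutoff x (5 * r) y).
      by rewrite indicE mem_set// mulr1 (le_trans (cutoff_le1 _ _ _)).
    by move=> /le_trans; apply; rewrite mulr_ge0// ltW.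
  + move=> y z a b; rewrite !lee_fin => ha hb.
    have a0 : 0 <= a by apply: le_trans ha; rewrite mulr_ge0// ltW.
    have b0 : 0 <= b by apply: le_trans hb; rewrite mulr_ge0// ltW.
    have d0 : 0 <= mdist y z `^ s by exact: powR_ge0.
    have [/supp By|] := ltP 0 (cutoff x (5 * r) y); last first.
      move=> /le_trans; apply.
      by rewrite addr_ge0 ?cutoff_ge0// mulr_ge0// addr_ge0.
    move: ha; rewrite indicE mem_set// mulr1 => ha.
    apply: le_trans (cutoff_holder _ _ _ _ z s_gt0 s_le1 r5) _.
    rewrite lerD2l ler_wpM2l//; apply: (@le_trans _ _ (r `^ (- s))); last by lra.
    rewrite !powRN lef_pV2 ?posrE ?powR_gt0//.
    by apply: ge0_ler_powR; rewrite ?nnegrE ?(ltW s_gt0) ?(ltW r5) ?(ltW r0)//; lra.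
- by move=> y By; exact: cutoff1.
- rewrite /energy; under eq_integral => y _.
    have -> : Phi_ext Phi (r `^ (- s) * \1_(ball x (10 * r)) y)%:E =
        ((Phi (r `^ (- s)))%:E * (\1_(ball x (10 * r)) y)%:E)%E.
      rewrite indicE; case: (y \in _); rewrite /= ?mulr1 ?mule1//.
      by rewrite mulr0 mule0 (growth_zero _ _ _ _ G).
    over.
  rewrite ge0_integralZl_EFin//.
  + by rewrite integral_indic// setIT.
  + exact/measurable_EFinP/measurable_indic.
  + exact: (growth_ge0 G) (ltW p0).
Qed.

End small_sets.

(** * Truncation *)

Section truncation.
Context {R : realType}.

Definition clamp (a : R) : R := Num.max 0 (Num.min 1 a).

Lemma clamp_ge0 a : 0 <= clamp a. Proof. by rewrite le_max lexx. Qed.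

Lemma clamp_le1 a : clamp a <= 1.
Proof. by rewrite ge_max ler01 ge_min lexx. Qed.

Lemma clamp_lip a b : clamp a <= clamp b + `|a - b|.
Proof.
have : a <= b + `|a - b| by rewrite -lerBlDl ler_norm.
have := normr_ge0 (a - b); set e := `|_|.
rewrite /clamp; case: (leP 1 a); case: (leP 1 b);
rewrite /Num.max; repeat case: ifP; lra.
Qed.

Lemma clamp_ge1 a : 1 <= a -> clamp a = 1.
Proof.
by move=> a1; apply/eqP; rewrite eq_le clamp_le1 le_max le_min lexx a1 orbT.
Qed.

Lemma clamp_le_norm a : clamp a <= `|a|.
Proof. by rewrite ge_max normr_ge0 ge_min ler_norm orbT. Qed.

Definition eclamp (a : \bar R) : R := fine (maxe 0%E (mine 1%E a)).

Lemma eclamp_fin a : a \is a fin_num -> eclamp a = clamp (fine a).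
Proof. by rewrite /eclamp; case: a => // a _; rewrite -EFin_min -EFin_max. Qed.

Lemma eclampy : eclamp +oo = 1.
Proof.
by rewrite /eclamp (min_idPl _) ?leey// (max_idPr _) ?lee_fin//= ler01 lexx.
Qed.

Lemma eclampNy : eclamp -oo = 0.
Proof. by rewrite /eclamp /Order.min /Order.max /= ?ltNyr ?ltNye /= ?lexx. Qed.

Lemma eclamp_ge0 a : 0 <= eclamp a.
Proof.
by case: a => [a| |]; rewrite ?eclampy ?eclampNy ?eclamp_fin ?clamp_ge0.
Qed.

Lemma eclamp_le1 a : eclamp a <= 1.
Proof.
by case: a => [a| |]; rewrite ?eclampy ?eclampNy ?eclamp_fin ?clamp_le1.
Qed.

Lemma eclamp_ge1 a : (1 <= a)%E -> eclamp a = 1.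
Proof.
case: a => [a| |]; rewrite ?eclampy// eclamp_fin// lee_fin.
exact: clamp_ge1.
Qed.

Lemma measurable_eclamp d (X : measurableType d) (f : X -> \bar R) :
  measurable_fun setT f -> measurable_fun setT (eclamp \o f).
Proof.
move=> mf; rewrite (_ : eclamp \o f =
  fine \o (fun x => maxe 0%E (mine 1%E (f x))))//.
apply: measurableT_comp; first exact: fine_measurable.
apply: measurable_maxe; first exact: measurable_cst.
by apply: measurable_mine => //; exact: measurable_cst.
Qed.

End truncation.

(** * Capacity in terms of the energy *)

Section capacity_and_energy.
Context {R : realType} {T : pmetricType R}.
Context (mu : {outer_measure set T -> \bar R}) (s : R) (Phi : R -> R).
Context {C K : R} (G : growth_function R Phi C K).
Notation cmu := (cara_measure mu).
Notation cT := (caratheodory_type mu).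
Notation small := (small mu s Phi).
Notation negligible_cap := (negligible_cap mu s Phi).
Notation energy := (energy mu Phi).
Notation norm := (orlicz_norm mu Phi).
Notation cap := (capacity mu s (orlicz_space mu Phi) norm).
Hypothesis (mu_regular : borel_regular mu).
Hypothesis (s_gt0 : 0 < s).

Lemma modularE u l : 0 < l ->
  orlicz_modular mu Phi u l = energy (fun x => (l^-1)%:E * `|u x|)%E.
Proof.
move=> l0; apply: eq_integral => x _; rewrite inver gt_eqF//.
by rewrite muleC.
Qed.

Lemma orlicz_norm_ge0 u : (0 <= norm u)%E.
Proof. by apply: le_ereal_inf_tmp => _ [l [l0 _] <-]; rewrite lee_fin ltW. Qed.

Lemma dotM_norm_ge0 u : (0 <= dotM_norm mu s norm u)%E.
Proof. by apply: le_ereal_inf_tmp => _ [g _ <-]; exact: orlicz_norm_ge0. Qed.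

(** The modular at a scale l <= K^-k is at most 1, and k halvings of Phi turn it
    into the energy, with a gain of 2^-k. *)
Lemma energy_of_norm k u : measurable_fun setT (u : cT -> \bar R) ->
  (norm u < (K ^- k)%:E)%E -> (energy (fun x => `|u x|) <= (2 ^- k)%:E)%E.
Proof.
have K0 : 0 < K by apply: lt_le_trans (growth_factor_ge2 _ _ _ _ G).
have Kk : 0 < K ^+ k by exact: exprn_gt0.
move=> mu_ /ereal_inf_lt[_ [l [l0 ul] <-]]; rewrite lte_fin => lk.
have mau : measurable_fun setT ((fun x => `|u x|%E) : cT -> \bar R).
  exact: measurableT_comp.
have := energy_half mu Phi G k _ (fun x => abse_ge0 (u x)) mau.
move=> /le_trans /(_ (_ : _ <= 1)%E) h.
rewrite -[leRHS]mule1 lee_pdivlMl ?exprn_gt0//.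
apply: h; apply: le_trans ul; rewrite modularE//.
apply: (le_energy mu Phi G).
- by move=> x; rewrite mule_ge0// lee_fin ltW.
- exact: emeasurable_funM.
- exact: emeasurable_funM.
- move=> x; apply: lee_wpmul2r => //; rewrite lee_fin.
  by rewrite -[leLHS]invrK lef_pV2 ?posrE ?invr_gt0// ltW.
Qed.

Lemma energy_lty_of_norm u : measurable_fun setT (u : cT -> \bar R) ->
  (norm u < +oo)%E -> (energy (fun x => `|u x|) < +oo)%E.
Proof.
move=> mu_ /ereal_inf_lt[_ [l [l0 ul] <-]] _.
have mau : measurable_fun setT ((fun x => `|u x|%E) : cT -> \bar R).
  exact: measurableT_comp.
have [D D1 HD] := energy_scale mu Phi G _ l0.
have := HD (fun x => (l^-1)%:E * `|u x|)%E.
have -> : (fun x => l%:E * ((l^-1)%:E * `|u x|))%E = (fun x => `|u x|)%E.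
  by apply/funext => x; rewrite muleA -EFinM divff ?gt_eqF// mul1e.
move=> /(_ _ _)/le_lt_trans; apply.
- by move=> x; rewrite mule_ge0// lee_fin invr_ge0 ltW.
- exact: emeasurable_funM.
- rewrite -modularE//; apply: (@le_lt_trans _ _ (D%:E * 1)%E).
    by apply: lee_wpmul2l => //; rewrite lee_fin (le_trans _ D1).
  by rewrite mule1 ltry.
Qed.

(** The gradient is set to +oo on the exceptional set. Comparing a point outside it
    with itself shows that u is finite wherever the new gradient is. *)
Lemma gradient_everywhere u g : s_gradient mu s u g ->
  exists g' : T -> \bar R,
  [/\ measurable_fun setT (g' : cT -> \bar R), forall x, (0 <= g' x)%E,
    (energy g' <= energy (fun x => `|g x|%E))%E,
    forall x, (g' x < +oo)%E -> u x \is a fin_num &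
    forall x y (a b : R), (g' x <= a%:E)%E -> (g' y <= b%:E)%E ->
      `|fine (u x) - fine (u y)| <= mdist x y `^ s * (a + b)].
Proof.
move=> [mg g0 [E E0 HE]].
have mE := null_cara mu mu_regular _ E0.
pose top (x : T) : \bar R := (+oo * (\1_E x)%:E)%E.
have topE x : top x = if x \in E then +oo%E else 0%E.
  by rewrite /top indicE; case: (x \in E); rewrite ?mule1 ?mule0.
have mtop : measurable_fun setT (top : cT -> \bar R).
  apply: emeasurable_funM; first exact: measurable_cst.
  exact/measurable_EFinP/measurable_indic.
have top0 x : (0 <= top x)%E by rewrite topE; case: ifP.
have notE x : (maxe (g x) (top x) < +oo)%E -> ~ E x.
  by move=> + Ex; rewrite gt_max topE mem_set// ltxx andbF.
have fin x : ~ E x -> u x \is a fin_num.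
  move=> nEx; have := HE x x nEx nEx.
  rewrite mdistxx powR0 ?gt_eqF// mul0e.
  by case: (u x).
exists (fun x => maxe (g x) (top x)); split.
- exact: measurable_maxe.
- by move=> x; rewrite le_max g0.
- apply: (@le_trans _ _ (energy g + energy top)%E).
    exact: (energy_max mu Phi G).
  rewrite [X in (_ + X)%E](_ : _ = 0%E) ?adde0.
    by rewrite (_ : (fun x => `|g x|%E) = g)//; apply/funext => x; rewrite gee0_abs.
  rewrite /energy (_ : (fun x => _) = top).
    rewrite /top ge0_integralZl//; last exact/measurable_EFinP/measurable_indic.
    by rewrite integral_indic// setIT (_ : cmu E = 0%E) ?mule0.
  apply/funext => x; rewrite topE; case: ifP => //= _.
  by rewrite (growth_zero _ _ _ _ G).
- by move=> x /notE; exact: fin.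
- move=> x y a b gx gy.
  have nx : ~ E x by apply: notE; apply: le_lt_trans gx (ltry _).
  have ny : ~ E y by apply: notE; apply: le_lt_trans gy (ltry _).
  have := HE x y nx ny; have := fin _ nx; have := fin _ ny.
  move: gx gy; rewrite !ge_max => /andP[gx _] /andP[gy _].
  case: (u x) => // ux; case: (u y) => // uy _ _ /=.
  move=> H; rewrite -lee_fin; apply: le_trans H _.
  rewrite EFinM EFinD; apply: lee_wpmul2l; first by rewrite lee_fin powR_ge0.
  exact: leeD.
Qed.

Lemma small_of_capacity (d : R) : 0 < d ->
  exists2 e : R, 0 < e & forall A, (cap A < e%:E)%E -> small d%:E A.
Proof.
move=> d0; have K0 : 0 < K by apply: lt_le_trans (growth_factor_ge2 _ _ _ _ G).
have [k kd] := archi_lt (2 / d).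
have {}kd : 2 / d <= 2 ^+ k by rewrite (le_trans (ltW kd))// natr_le_exp2.
exists (K ^- k); first by rewrite invr_gt0 exprn_gt0.
move=> A /ereal_inf_lt[_ [v [[Mv [Lv _]] [U [oU AU Uv]]] <-]] vk.
have mv : measurable_fun setT (v : cT -> \bar R) by case: Lv.
have nv : (norm v < (K ^- k)%:E)%E.
  by apply: le_lt_trans vk; rewrite leeDl// dotM_norm_ge0.
have : (dotM_norm mu s norm v < (K ^- k)%:E)%E.
  by apply: le_lt_trans vk; rewrite leeDr// orlicz_norm_ge0.
move=> /ereal_inf_lt[_ [g vg <-] ng].
have mg : measurable_fun setT (g : cT -> \bar R) by case: vg.
have [g' [mg' g'0 eg' fing' gradg']] := gradient_everywhere _ _ vg.
have mav : measurable_fun setT ((fun x => `|v x|%E) : cT -> \bar R).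
  exact: measurableT_comp.
exists U, (eclamp \o v), (fun x => maxe `|v x|%E (g' x)); split => //.
- split => /=.
  + exact: measurable_eclamp.
  + exact: measurable_maxe.
  + by move=> x; exact: eclamp_ge0.
  + by move=> x; exact: eclamp_le1.
  + by move=> x; rewrite le_max abse_ge0.
  + move=> x a; rewrite ge_max => /andP[va ga].
    have vf : v x \is a fin_num by apply: fing'; apply: le_lt_trans ga (ltry _).
    rewrite eclamp_fin//; apply: le_trans (clamp_le_norm _) _.
    by rewrite -lee_fin -abse_EFin fineK.
  + move=> x y a b; rewrite !ge_max => /andP[_ ga] /andP[_ gb].
    have vx : v x \is a fin_num by apply: fing'; apply: le_lt_trans ga (ltry _).
    have vy : v y \is a fin_num by apply: fing'; apply: le_lt_trans gb (ltry _).
    rewrite !eclamp_fin//; apply: le_trans (clamp_lip _ (fine (v y))) _.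
    by rewrite lerD2l gradg'.
- by move=> x /Uv; exact: eclamp_ge1.
- apply: le_trans (energy_max mu Phi G _ _ _ _ _ _) _ => //.
  have vk' := energy_of_norm _ _ mv nv; have gk := energy_of_norm _ _ mg ng.
  apply: le_trans (leeD vk' (le_trans eg' gk)) _.
  have : 2 ^- k <= (2 / d)^-1.
    by rewrite lef_pV2// posrE ?divr_gt0 ?exprn_gt0.
  by rewrite invf_div -EFinD lee_fin; lra.
Qed.

Lemma capacity_eq0 A : negligible_cap A -> cap A = 0%E.
Proof.
move=> nA; apply/eqP; rewrite eq_le; apply/andP; split; last first.
  apply: le_ereal_inf_tmp => _ [v _ <-].
  by rewrite adde_ge0// ?orlicz_norm_ge0// dotM_norm_ge0.
apply/lee_addgt0Pr => e e0; rewrite add0e.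
have l0 : 0 < e / 2 by rewrite divr_gt0.
have l0' : 0 < (e / 2)^-1 by rewrite invr_gt0.
have [D D1 HD] := energy_scale mu Phi G _ l0'.
have D0 : 0 < D by exact: lt_le_trans D1.
have [|U [v [h [oU AU vh v1 hd]]]] := nA D^-1; first by rewrite invr_gt0.
have h0 := test_grad_ge0 _ _ _ _ vh.
have mh := test_grad_measurable _ _ _ _ vh.
have v0 := test_ge0 _ _ _ _ vh.
have mv : measurable_fun setT ((EFin \o v) : cT -> \bar R).
  by apply/measurable_EFinP; exact: test_measurable vh.
have hmod : (orlicz_modular mu Phi h (e / 2) <= 1)%E.
  rewrite modularE// (_ : (fun x => _) = (fun x => (e / 2)^-1%:E * h x)%E).
    apply: le_trans (HD _ h0 mh) _; rewrite -(@lee_pdivlMl _ D)// mule1.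
    exact: hd.
  by apply/funext => x; rewrite gee0_abs.
have vmod : (orlicz_modular mu Phi (EFin \o v) (e / 2) <= 1)%E.
  apply: le_trans hmod; rewrite !modularE//; apply: (le_energy mu Phi G).
  - by move=> x; rewrite mule_ge0// lee_fin ltW.
  - apply: emeasurable_funM => //; exact: measurableT_comp.
  - apply: emeasurable_funM => //; exact: measurableT_comp.
  - move=> x; apply: lee_wpmul2l; first by rewrite lee_fin ltW.
    rewrite (gee0_abs (h0 x)) gee0_abs ?lee_fin//=.
    case E : (h x) => [a| |]; rewrite ?leey//; last by have := h0 x; rewrite E.
    by rewrite lee_fin; apply: test_le_grad vh _ _ _; rewrite E.
have nle u : (orlicz_modular mu Phi u (e / 2) <= 1 -> norm u <= (e / 2)%:E)%E.
  by move=> um; apply: ereal_inf_lbound; exists (e / 2).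
have grad : s_gradient mu s (EFin \o v) h.
  split=> //; exists set0; first exact: outer_measure0.
  move=> x y _ _ /=.
  have [->|xy] := eqVneq x y.
    by rewrite subrr normr0 mule_ge0 ?adde_ge0// lee_fin powR_ge0.
  have p0 : 0 < mdist x y `^ s by rewrite powR_gt0// mdist_gt0.
  have := h0 x; have := h0 y.
  case Ex : (h x) => [a| |]//; case Ey : (h y) => [b| |]// _ _;
    rewrite ?addye ?addey ?gt0_muley ?leey ?lte_fin//.
  rewrite -EFinD -EFinM lee_fin.
  have hx : (h x <= a%:E)%E by rewrite Ex.
  have hy : (h y <= b%:E)%E by rewrite Ey.
  have := test_holder _ _ _ _ vh x y a b hx hy.
  have := test_holder _ _ _ _ vh y x b a hy hx.
  rewrite (metric_sym y) (addrC b); set P := _ * _ => H1 H2.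
  by rewrite ler_norml; apply/andP; split; lra.
have dn : (dotM_norm mu s norm (EFin \o v) <= (e / 2)%:E)%E.
  apply: le_trans (nle _ hmod); apply: ereal_inf_lbound.
  by exists h.
have Lv : L0 mu (EFin \o v) by split => //; exact: aeW.
apply: (@le_trans _ _ (M_norm mu s norm (EFin \o v))).
  apply: ereal_inf_lbound; exists (EFin \o v) => //; split.
    split; split => //; first exact: le_lt_trans dn (ltry _).
    by exists (e / 2) => //; exact: le_lt_trans vmod (ltry _).
  by exists U; split => // x Ux /=; rewrite v1.
have -> : e = e / 2 + e / 2 by rewrite -splitr.
by rewrite EFinD; apply: leeD => //; exact: nle.
Qed.

End capacity_and_energy.

(** * Small unions of balls and sets of positive density *)

Section small_unions_of_balls.
Context {R : realType} {T : pmetricType R}.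
Context (mu : {outer_measure set T -> \bar R}) (s : R) (Phi : R -> R).
Context {C K : R} (G : growth_function R Phi C K).
Notation cmu := (cara_measure mu).
Notation cT := (caratheodory_type mu).
Notation small := (small mu s Phi).
Notation energy := (energy mu Phi).
Notation B p := (ball p.1 p.2).
Hypothesis (mu_regular : borel_regular mu).
Hypothesis (mu_balls : balls_pos_finite mu).
Hypothesis (mu_doubling : doubling_measure mu).
Hypothesis (s_gt0 : 0 < s) (s_le1 : s <= 1).

Let mB x r : measurable (ball x r : set cT).
Proof. exact: (measurable_metric_ball mu mu_regular). Qed.

(** Each ball costs the energy Phi (r^-s) mu (B) of a cutoff, which the integral of
    f over the ball pays for; along a disjoint Vitali subfamily, whose fivefold
    enlargements still cover, these integrals add up to at most that of f. *)
Lemma small_bigcup_balls : exists2 M : R, 0 < M &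
  forall (F : set (T * R)) (f : T -> \bar R) (k : R),
  (forall p, F p -> 0 < p.2 <= 1) -> 0 <= k ->
  measurable_fun setT (f : cT -> \bar R) -> (forall x, 0 <= f x)%E ->
  (\int[cmu]_x f x < +oo)%E ->
  (forall p, F p -> ((Phi (p.2 `^ (- s)))%:E * mu (B p) <=
     k%:E * \int[cmu]_(x in B p) f x)%E) ->
  small ((M * k)%:E * \int[cmu]_x f x)%E (\bigcup_(p in F) B p).
Proof.
have [Db Db1 HDb] := doubling_ball mu_doubling.
have Db0 : 0 < Db by exact: lt_le_trans Db1.
have C0 : 0 < C by apply: lt_le_trans (growth_const_ge1 _ _ _ _ G).
exists (C * Db) => [|F f k F01 k0 mf f0 foo HF]; first by rewrite mulr_gt0.
have [D [DF tD cov]] := vitali_disjoint_subfamily F 1 F01.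
have D0 p : D p -> 0 < p.2 by move=> /DF/F01/andP[].
have pos p : D p -> (0 < \int[cmu]_(x in B p) f x)%E.
  move=> Dp; rewrite lt_neqAle integral_ge0// andbT; apply/eqP => E.
  have := HF _ (DF _ Dp); rewrite -E mule0 leNgt => /negP; apply.
  rewrite mule_gt0 ?lte_fin ?(growth_pos _ _ _ _ G) ?powR_gt0 ?D0//.
  by have /andP[] := mu_balls p.1 _ (D0 _ Dp).
(* The numbering e turns the union over D into one indexed by nat. *)
have /countable_injP[e inje] : countable D.
  apply: (trivIset_integral_countable _ _ _ cmu _ D (fun p => B p : set cT) f) => //.
pose A n := \bigcup_(p in [set p | D p /\ e p = n]) ball p.1 (5 * p.2).
pose Bn n := \bigcup_(p in [set p | D p /\ e p = n]) B p.
have single n p : D p -> e p = n -> [set p | D p /\ e p = n] = [set p].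
  move=> Dp ep; apply/seteqP; split => [q [Dq eq_]|_ ->//].
  by apply: inje; rewrite ?inE// eq_ ep.
have mBn n : measurable (Bn n : set cT).
  have [[p [Dp ep]]|nex] := pselect (exists p, D p /\ e p = n).
    by rewrite /Bn (single n p)// bigcup_set1.
  rewrite /Bn (_ : [set _ | _] = set0) ?bigcup_set0; first exact: measurable0.
  by apply/seteqP; split => // p Hp; apply: nex; exists p.
have sA n : small ((Db * k)%:E * \int[cmu]_(x in Bn n) f x)%E (A n).
  have [[p [Dp ep]]|nex] := pselect (exists p, D p /\ e p = n); last first.
    rewrite /A /Bn (_ : [set _ | _] = set0) ?bigcup_set0.
      by rewrite integral_set0 mule0; exact: (small_set0 mu s Phi G).
    by apply/seteqP; split => // p Hp; apply: nex; exists p.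
  rewrite /A /Bn (single n p)// !bigcup_set1.
  have /andP[p0 p1] := F01 _ (DF _ Dp).
  apply: small_le (small_ball mu s Phi G mu_regular s_gt0 s_le1 _ _ p0 p1);
    last exact: subset_refl.
  apply: (@le_trans _ _ ((Phi (p.2 `^ (- s)))%:E * (Db%:E * mu (B p)))%E).
    apply: lee_wpmul2l; first by rewrite lee_fin (growth_ge0 G)// powR_ge0.
    apply: le_trans (HDb p.1 _ p0); apply: le_outer_measure.
    by apply: le_ball; rewrite ler_wpM2r ?(ltW p0)// ler_nat.
  rewrite muleCA EFinM -muleA; apply: lee_wpmul2l; first by rewrite lee_fin ltW.
  exact: HF (DF _ Dp).
have sumB : (\sum_(0 <= n <oo) \int[cmu]_(x in Bn n) f x <= \int[cmu]_x f x)%E.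
  rewrite -ge0_integral_bigcup//.
  - apply: ge0_subset_integral => //; exact: bigcup_measurable.
  - exact: measurable_funS mf.
  - move=> i j _ _ [x [[p [Dp ep] px] [q [Dq eq_] qx]]].
    by rewrite -ep -eq_; congr e; apply: tD => //; exists x.
have I0 n : (0 <= \int[cmu]_(x in Bn n) f x)%E by exact: integral_ge0.
apply: small_le (small_bigcup mu s Phi G _ _ sA).
  rewrite nneseriesZl// !EFinM -!muleA.
  apply: lee_wpmul2l; first by rewrite lee_fin ltW.
  apply: lee_wpmul2l; first by rewrite lee_fin ltW.
  by apply: lee_wpmul2l; rewrite ?lee_fin.
move=> x [p Fp px]; have [q Dq pq] := cov _ Fp.
by exists (e q) => //; exists q => //; exact: pq.
Qed.

(** Where v >= 1/2 the new function is already 1, so the cutoffs only have to be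
    controlled where v < 1/2, and there 12 h exceeds their Hoelder constants. The
    family may be uncountable and overlapping. *)
Lemma small_bigcup_cutoffs (v : T -> R) (h : T -> \bar R) (F : set (T * R)) :
  test_pair mu s v h -> (forall p, F p -> 0 < p.2 <= 1) ->
  (forall p z, F p -> ball p.1 (2 * p.2) z -> v z < 2^-1 ->
    ((p.2 `^ (- s) / 12)%:E <= h z)%E) ->
  small (energy (fun x => 12%:E * h x)%E) (\bigcup_(p in F) B p).
Proof.
move=> vh F01 HF.
have F0 p : F p -> 0 < p.2 by move=> /F01/andP[].
have pw p : F p -> 1 <= p.2 `^ (- s).
  by move=> Fp; have /andP[p0 p1] := F01 _ Fp; exact: powRN_ge1.
have v0 := test_ge0 _ _ _ _ vh; have v1 := test_le1 _ _ _ _ vh.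
have h0 := test_grad_ge0 _ _ _ _ vh; have vleh := test_le_grad _ _ _ _ vh.
have ub x : has_ubound [set cutoff p.1 p.2 x | p in F].
  by exists 1 => _ [p _ <-]; exact: cutoff_le1.
have supU x (M : R) : 0 <= M -> (forall p, F p -> cutoff p.1 p.2 x <= M) ->
    sup [set cutoff p.1 p.2 x | p in F] <= M.
  move=> M0 HM; have [->|/set0P[p Fp]] := eqVneq F set0.
    by rewrite image_set0 sup0.
  by apply: ge_sup => [|_ [q Fq <-]]; [exists (cutoff p.1 p.2 x), p|exact: HM].
have supL x p : F p -> cutoff p.1 p.2 x <= sup [set cutoff p.1 p.2 x | p in F].
  by move=> Fp; apply: ub_le_sup => //; exists p.
pose w x := Num.max (Num.min 1 (2 * v x))
  (sup [set cutoff p.1 p.2 x | p in F]).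
have w1 x : w x <= 1.
  by rewrite ge_max ge_min lexx/= supU// => p _; exact: cutoff_le1.
have w_big x : 2^-1 <= v x -> w x = 1.
  move=> vx; apply/eqP; rewrite eq_le w1/= le_max le_min lexx/=.
  by apply/orP; left; lra.
have wv x : Num.min 1 (2 * v x) <= w x by rewrite le_max lexx.
have w0 x : 0 <= w x.
  by apply: le_trans (wv x); rewrite le_min ler01 mulr_ge0.
have h12 x (a : R) : (12%:E * h x <= a%:E)%E -> (h x <= (a / 12)%:E)%E.
  by move=> H; rewrite EFinM lee_pdivlMr// muleC.
have hgood z p (a : R) : F p -> v z < 2^-1 -> 0 < cutoff p.1 p.2 z ->
    (12%:E * h z <= a%:E)%E -> p.2 `^ (- s) <= a.
  move=> Fp vz cz ha.
  have := le_trans (HF p z Fp (cutoff_supp _ _ _ (F0 _ Fp) cz) vz) (h12 _ _ ha).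
  by rewrite lee_fin ler_pM2r.
exists (\bigcup_(p in F) B p), w, (fun x => 12%:E * h x)%E; split => //.
- by apply: bigcup_open => p _; exact: open_metric_ball.
- split => //.
  + apply: measurable_maxr; last exact: (measurable_sup_cutoff mu mu_regular).
    apply: measurable_minr; first exact: measurable_cst.
    by apply: measurable_funM; [exact: measurable_cst|exact: test_measurable vh].
  + by apply: emeasurable_funM => //; exact: test_grad_measurable vh.
  + by move=> x; rewrite mule_ge0.
  + move=> x a ha; have := vleh _ _ (h12 _ _ ha) => va.
    have := v0 x; have [vx|vx] := leP 2^-1 (v x).
      by rewrite w_big//; lra.
    rewrite ge_max ge_min => vx0; apply/andP; split.
      by apply/orP; right; lra.
    apply: supU => [|p Fp]; first lra.
    have [cp|cp] := ltP 0 (cutoff p.1 p.2 x); last by apply: le_trans cp _; lra.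
    apply: le_trans (cutoff_le1 _ _ _) (le_trans (pw _ Fp) _).
    exact: hgood cp ha.
  + move=> x y a b ha hb.
    have va := vleh _ _ (h12 _ _ ha); have vb := vleh _ _ (h12 _ _ hb).
    have d0 : 0 <= mdist x y `^ s by exact: powR_ge0.
    have a0 : 0 <= a by have := v0 x; lra.
    have b0 : 0 <= b by have := v0 y; lra.
    have dab : 0 <= mdist x y `^ s * (a + b) by rewrite mulr_ge0// addr_ge0.
    have [vy|vy] := leP 2^-1 (v y).
      by rewrite (w_big y)// (le_trans (w1 x))// lerDl.
    have hol := test_holder _ _ _ _ vh x y _ _ (h12 _ _ ha) (h12 _ _ hb).
    have hv : Num.min 1 (2 * v x) <= w y + mdist x y `^ s * (a + b).
      rewrite ge_min; apply/orP; right.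
      have := wv y; rewrite ge_min => /orP[|]; last first.
        move: hol; rewrite -mulrDl mulrA; set P := _ * (a + b) in dab *.
        by lra.
      by have := w1 y; have := v1 x; have := v1 y; move: vy; lra.
    have [vx|vx] := leP 2^-1 (v x).
      by rewrite (w_big x)//; move: hv; rewrite (min_idPl _)//; lra.
    rewrite ge_max hv/=; apply: supU => [|p Fp]; first by rewrite addr_ge0.
    have [cp|cp] := ltP 0 (cutoff p.1 p.2 x); last first.
      by apply: le_trans cp _; rewrite addr_ge0.
    apply: le_trans (cutoff_holder _ _ _ x y s_gt0 s_le1 (F0 _ Fp)) _.
    apply: lerD; first by rewrite le_max supL ?orbT.
    apply: ler_wpM2l => //; have := hgood _ _ _ Fp vx cp ha; lra.
- move=> x [p Fp px]; apply/eqP; rewrite eq_le w1/= le_max; apply/orP; right.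
  by apply: le_trans (supL _ _ Fp); rewrite cutoff1// F0.
Qed.

(** The balls in which {v = 1} has density at least g split into two families. In
    F1 the gradient is large on {v = 1}, hence on a fixed proportion of the ball.
    Outside F1 some y in the ball has v y = 1 and h y small; a point z of the
    doubled ball with v z < 1/2 then has h z large, because v drops by 1/2 over a
    distance of at most 3 r. *)
Lemma small_density (g : R) : 0 < g -> exists2 M : R, 0 < M &
  forall v h, test_pair mu s v h -> (energy h < +oo)%E ->
  small (M%:E * energy h)%E
    [set x | exists r, [/\ 0 < r, r <= 1 & (g%:E * mu (ball x r) <=
      mu ([set y | v y = 1%R] `&` ball x r))%E]].
Proof.
move=> g0; have C1 := growth_const_ge1 _ _ _ _ G.
have [M1 M10 HM1] := small_bigcup_balls.
have [D D1 HD] := growth_scale G 12 (ler0n _ _).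
have [E E1 HE] := energy_scale mu Phi G 12 (ltr0n _ 12).
have D0 : 0 < D by exact: lt_le_trans D1.
have E0 : 0 < E by exact: lt_le_trans E1.
exists (C * (M1 * (D / g) + E)).
  by rewrite mulr_gt0 ?(lt_le_trans _ C1)// addr_gt0// mulr_gt0// divr_gt0.
move=> v h vh eh.
have mh := test_grad_measurable _ _ _ _ vh.
have h0 := test_grad_ge0 _ _ _ _ vh.
have mv : measurable ([set y | v y = 1] : set cT).
  have := test_measurable _ _ _ _ vh measurableT [set 1] (measurable_set1 _).
  by rewrite setTI.
(* The constant 12: (3 r)^s (t + t) <= 1/2 for t = r^-s / 12. *)
pose dens (p : T * R) := (g%:E * mu (B p) <= mu ([set y | v y = 1%R] `&` B p))%E.
pose F1 := [set p : T * R | [/\ 0 < p.2 <= 1, dens p &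
  forall y, B p y -> v y = 1 -> ((p.2 `^ (- s) / 12)%:E <= h y)%E]].
pose F2 := [set p : T * R | 0 < p.2 <= 1 /\
  forall z, ball p.1 (2 * p.2) z -> v z < 2^-1 ->
  ((p.2 `^ (- s) / 12)%:E <= h z)%E].
have S1 : small ((M1 * (D / g))%:E * energy h)%E (\bigcup_(p in F1) B p).
  apply: HM1 => //.
  - by move=> p [].
  - by rewrite ltW// divr_gt0.
  - exact: (measurable_energy mu Phi G).
  - by move=> x; exact: (Phi_ext_ge0 G).
  move=> [x r] [/= /andP[r0 r1] dp hp].
  set t := r `^ (- s) / 12; have t0 : 0 < t by rewrite divr_gt0 ?powR_gt0.
  have Phit0 : 0 <= Phi t by rewrite (growth_ge0 G) ?ltW.
  have -> : r `^ (- s) = 12 * t by rewrite /t mulrC divfK.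
  apply: (@le_trans _ _ ((D / g)%:E * ((Phi t)%:E * (g%:E * mu (ball x r))))%E).
    rewrite !muleA -!EFinM; apply: lee_wpmul2r; first exact: outer_measure_ge0.
    rewrite lee_fin; have := HD t (ltW t0).
    by rewrite (_ : D / g * Phi t * g = D * Phi t)//; field; rewrite gt_eqF.
  apply: lee_wpmul2l; first by rewrite lee_fin ltW// divr_gt0.
  apply: (@le_trans _ _ ((Phi t)%:E * mu ([set y | v y = 1%R] `&` ball x r))%E).
    by apply: lee_wpmul2l.
  have mvB : measurable ([set y | v y = 1] `&` ball x r : set cT).
    by apply: measurableI.
  have mP : measurable_fun setT ((fun y => Phi_ext Phi (h y)) : cT -> \bar R).
    exact: (measurable_energy mu Phi G).
  apply: (@le_trans _ _ (\int[cmu]_(y in [set y | v y = 1%R] `&` ball x r)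
      Phi_ext Phi (h y))%E).
    rewrite -(integral_cst cmu mvB); apply: ge0_le_integral => //.
    + exact: measurable_funTS.
    + move=> y [vy By]; apply: (le_Phi_ext G _ _ _ (hp _ By vy)).
      by rewrite lee_fin ltW.
  apply: ge0_subset_integral => //.
  - exact: measurable_funTS.
  - by move=> y _; exact: (Phi_ext_ge0 G).
have S2 : small (E%:E * energy h)%E (\bigcup_(p in F2) B p).
  apply: small_le (HE h h0 mh) (@subset_refl _ _) _.
  apply: small_bigcup_cutoffs vh _ _.
    by move=> p [].
  by move=> p z [_ +] pz vz; apply.
apply: small_le (small_setU mu s Phi G _ _ _ _ S1 S2).
  have q0 : (0 <= (M1 * (D / g))%:E)%E.
    by rewrite lee_fin ltW// mulr_gt0// divr_gt0.
  have E0' : (0 <= E%:E)%E by rewrite lee_fin ltW.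
  by rewrite -ge0_muleDl// muleA -EFinD -EFinM.
move=> x [r [r0 r1 dr]].
have [H1|H1] := pselect (F1 (x, r)).
  by left; exists (x, r) => //; exact: mem_ball_center.
right; exists (x, r); last exact: mem_ball_center.
split; first by rewrite r0.
move=> /= z xz vz; rewrite leNgt; apply/negP => hz; apply: H1.
split => /=; [by rewrite r0|exact: dr|move=> y xy vy].
rewrite leNgt; apply/negP => hy.
have := test_holder _ _ _ _ vh y z _ _ (ltW hy) (ltW hz).
rewrite vy leNgt => /negP; apply.
have d3 : mdist y z <= 3 * r.
  move: xz xy; rewrite !mem_ball => xz xy.
  by have := metric_triangle y x z; rewrite (metric_sym y x); lra.
have rs0 : 0 < r `^ s by rewrite powR_gt0.
have ds : mdist y z `^ s <= 3 * r `^ s.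
  apply: (@le_trans _ _ ((3 * r) `^ s)).
    by apply: ge0_ler_powR; rewrite ?nnegrE ?mdist_ge0 ?mulr_ge0// ltW.
  rewrite powRM ?(ltW r0)//; apply: ler_wpM2r; first exact: ltW.
  by rewrite -[leRHS]powRr1// ler_powR// ler1n.
have rr : r `^ s * r `^ (- s) = 1 by rewrite powRN divff// gt_eqF.
have q0 : 0 < r `^ (- s) by rewrite powR_gt0.
have : mdist y z `^ s * (r `^ (- s) / 12 + r `^ (- s) / 12) <=
    3 * r `^ s * (r `^ (- s) / 12 + r `^ (- s) / 12).
  by apply: ler_wpM2r => //; lra.
have -> : 3 * r `^ s * (r `^ (- s) / 12 + r `^ (- s) / 12) =
    (r `^ s * r `^ (- s)) / 2 by field.
by rewrite rr; move: vz; lra.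
Qed.

End small_unions_of_balls.

(** * Generalized Lebesgue points *)

Section near_right.
Context {R : realType}.

Lemma near_right0 (P : R -> Prop) (d : R) : 0 < d ->
  (forall r, 0 < r -> r < d -> P r) -> \forall r \near (0 : R)^'+, P r.
Proof.
move=> d0 H; near=> r; apply: H; first by near: r; exact: nbhs_right_gt.
by near: r; exact: nbhs_right_lt.
Unshelve. all: by end_near. Qed.

Lemma cvg_right0_EFin (f : R -> \bar R) (l : R) :
  (forall e, 0 < e -> exists2 d, 0 < d & forall r, 0 < r -> r < d ->
    ((l - e)%:E <= f r <= (l + e)%:E)%E) ->
  f r @[r --> (0 : R)^'+] --> l%:E.
Proof.
move=> H; apply/fine_cvgP; split.
  have [d d0 Hd] := H 1 ltr01; apply: near_right0 d0 _ => r r0 rd.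
  have := Hd r r0 rd; case: (f r) => // /andP[]; by rewrite ?leye_eq ?leeNy_eq.
apply/cvgrPdist_le => e e0; have [d d0 Hd] := H e e0.
apply: near_right0 d0 _ => r r0 rd /=.
have := Hd r r0 rd; case: (f r) => [a| |] /andP[]; rewrite ?leye_eq ?leeNy_eq//.
by rewrite !lee_fin /= ler_norml => h1 h2; apply/andP; split; lra.
Qed.

End near_right.

Section generalized_lebesgue_points.
Context {R : realType} {T : pmetricType R}.
Context (mu : {outer_measure set T -> \bar R}) (s : R) (Phi : R -> R).
Context {C K : R} (G : growth_function R Phi C K).
Notation cmu := (cara_measure mu).
Notation cT := (caratheodory_type mu).
Notation small := (small mu s Phi).
Notation negligible_cap := (negligible_cap mu s Phi).
Notation energy := (energy mu Phi).
Hypothesis (mu_regular : borel_regular mu).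
Hypothesis (mu_balls : balls_pos_finite mu).
Hypothesis (mu_doubling : doubling_measure mu).
Hypothesis (s_gt0 : 0 < s) (s_le1 : s <= 1).
Context (u : T -> \bar R).

Lemma within_ball (E : set T) x (V : set (\bar R)) :
  {within ~` E, continuous u} -> ~ E x -> nbhs (u x) V ->
  exists2 d, 0 < d & forall y, ball x d y -> ~ E y -> V (u y).
Proof.
move=> cu nEx uV.
have : within (~` E) (nbhs x) (u @^-1` V).
  by rewrite nbhs_subspace_in//; exact: cu x V uV.
move=> /nbhs_ballP[d /= d0 Hd].
by exists d => // y xy nEy; exact: Hd.
Qed.

(** E is one of the exceptional sets that quasicontinuity provides; it may depend
    on the density g. *)
Definition quasi_regular (g : R) (x : T) : Prop :=
  exists E : set T, [/\ {within ~` E, continuous u}, ~ E x &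
    forall r, 0 < r -> r <= 1 ->
      (mu (E `&` ball x r) < g%:E * mu (ball x r))%E].

(** A test pair for an exceptional set E of small capacity has v = 1 on E, so the
    points where E is dense are covered by [small_density]. *)
Lemma quasi_regular_qe (g : R) : 0 < g ->
  quasicontinuous mu s (orlicz_space mu Phi) (orlicz_norm mu Phi) u ->
  negligible_cap [set x | ~ quasi_regular g x].
Proof.
move=> g0 qc d d0.
have [M M0 HM] := small_density mu s Phi G mu_regular mu_balls mu_doubling
  s_gt0 s_le1 _ g0.
have C0 : 0 < C by apply: lt_le_trans (growth_const_ge1 _ _ _ _ G).
pose d' := d / (C * (1 + M)).
have d'0 : 0 < d' by rewrite divr_gt0// mulr_gt0// addr_gt0.
have [e e0 He] := small_of_capacity mu s Phi G mu_regular s_gt0 _ d'0.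
have [E capE cE] := qc e e0.
have sE := He _ capE; have [U [v [h [oU EU vh v1 hd]]]] := sE.
have := HM _ _ vh (le_lt_trans hd (ltry _)); set S := [set x | _] => sS.
have {}sS : small (M%:E * d'%:E)%E S.
  by apply: small_le sS => //; apply: lee_wpmul2l => //; rewrite lee_fin ltW.
apply: small_le (small_setU mu s Phi G _ _ _ _ sE sS).
  suff : ((C * (d' + M * d'))%:E <= d%:E)%E by [].
  rewrite lee_fin /d' (_ : C * _ = d)//.
  by field; rewrite !gt_eqF// addr_gt0.
move=> x /= nq; apply: contrapT => /not_orP[nEx nSx]; apply: nq.
exists E; split => // r r0 r1; rewrite ltNge; apply/negP => H; apply: nSx.
exists r; split => //; apply: le_trans H _; apply: le_outer_measure.
by apply: setSI => y /EU /v1.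
Qed.

Lemma quasi_regular_le g g' x : g <= g' -> quasi_regular g x -> quasi_regular g' x.
Proof.
move=> gg [E [cE nEx H]]; exists E; split => // r r0 r1.
by apply: lt_le_trans (H r r0 r1) _; rewrite lee_wpmul2r// outer_measure_ge0.
Qed.

Lemma quasi_regular_ball (g e : R) x : u x \is a fin_num -> 0 < e ->
  quasi_regular g x -> exists2 d, 0 < d & forall r, 0 < r -> r < d ->
  (mu (ball x r `&` [set y | ~ ((fine (u x) - e)%:E < u y < (fine (u x) + e)%:E)%E])
    < g%:E * mu (ball x r))%E.
Proof.
move=> ufin e0 [E [cE nEx H]].
pose V : set (\bar R) :=
  [set z | ((fine (u x) - e)%:E < z)%E] `&` [set z | (z < (fine (u x) + e)%:E)%E].
have nV : nbhs (u x) V.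
  rewrite -(fineK ufin); apply: filterI.
    by apply: (@nbhs_open_ereal_gt _ _ (fun=> fine (u x) - e)); lra.
  by apply: (@nbhs_open_ereal_lt _ _ (fun=> fine (u x) + e)); lra.
have [d d0 Hd] := within_ball _ _ _ cE nEx nV.
exists (Num.min d 1) => [|r r0]; first by rewrite lt_min d0/=.
rewrite lt_min => /andP[rd r1].
apply: le_lt_trans (H r r0 (ltW r1)); apply: le_outer_measure => y [xy ny].
split => //; apply: contrapT => nEy; apply: ny.
have [] := Hd y (le_ball (ltW rd) xy) nEy.
by move=> /= -> ->.
Qed.

(** Less than the proportion g of the ball lies above hi, and less than 1 - g lies
    at or below lo. *)
Lemma median_between (g lo hi : R) (w : T -> \bar R) x r :
  0 < g -> g < 1 -> 0 < r ->
  (mu (ball x r `&` [set y | ~ (lo%:E < w y <= hi%:E)%E]) <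
    (Num.min g (1 - g))%:E * mu (ball x r))%E ->
  (lo%:E <= median mu g w (ball x r) <= hi%:E)%E.
Proof.
move=> g0 g1 r0; set S := _ `&` _ => HS.
have /andP[B0 Boo] := mu_balls x r r0.
have Bfin : mu (ball x r) \is a fin_num by rewrite ge0_fin_numE// ltW.
have b0 : 0 < fine (mu (ball x r)) by rewrite fine_gt0// B0.
apply/andP; split.
  apply: le_ereal_inf_tmp => _ [a aS <-]; rewrite leNgt; apply/negP => alo.
  have cov : ball x r `<=` S `|` [set y | ball x r y /\ (a%:E < w y)%E].
    move=> y xy; have [wy|wy] := pselect (lo%:E < w y <= hi%:E)%E.
      right; split => //; have /andP[lw _] := wy; exact: lt_trans lw.
    by left.
  have := le_trans (le_outer_measure mu _ _ cov) (outer_measureU2 mu _ _).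
  have S1 : (mu S < (1 - g)%:E * mu (ball x r))%E.
    apply: lt_le_trans HS _; apply: lee_wpmul2r; first exact: ltW.
    by rewrite lee_fin ge_min lexx orbT.
  rewrite leNgt => /negP; apply.
  apply: lt_le_trans (lteD S1 aS) _.
  by rewrite -(fineK Bfin) -!EFinM -EFinD lee_fin -mulrDl subrK mul1r.
apply: ereal_inf_lbound; exists hi => //=.
apply: (@le_lt_trans _ _ (mu S)).
  apply: le_outer_measure => y [xy wy]; split => //= /andP[_].
  by rewrite leNgt wy.
apply: lt_le_trans HS _; apply: lee_wpmul2r; first exact: ltW.
by rewrite lee_fin ge_min lexx.
Qed.

Lemma generalized_lebesgue_of_quasi_regular x : u x \is a fin_num ->
  (forall g, 0 < g -> quasi_regular g x) -> generalized_lebesgue_point mu u x.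
Proof.
move=> ufin H g /andP[g0 g1].
have mg0 : 0 < Num.min g (1 - g) by rewrite lt_min g0 subr_gt0.
split.
  apply: cvg_right0_EFin => e e0.
  have [d d0 Hd] := quasi_regular_ball _ _ _ ufin e0 (H _ mg0).
  exists d => // r r0 rd; rewrite sub0r add0r.
  apply: median_between => //; apply: le_lt_trans (Hd r r0 rd).
  apply: le_outer_measure => y [xy ny]; split => // /andP[ulo uhi]; apply: ny.
  move: ufin ulo uhi; case: (u x) => // b _ /=; case: (u y) => // a.
  rewrite !lte_fin => h1 h2; rewrite /= ?lte_fin ?lee_fin; apply/andP; split.
    by rewrite (lt_le_trans _ (normr_ge0 _))// oppr_lt0.
  by rewrite ler_norml; apply/andP; split; lra.
rewrite -(fineK ufin); apply: cvg_right0_EFin => e e0.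
have [d d0 Hd] := quasi_regular_ball _ _ _ ufin e0 (H _ mg0).
exists d => // r r0 rd; apply: median_between => //.
apply: le_lt_trans (Hd r r0 rd).
apply: le_outer_measure => y [xy ny]; split => // /andP[ulo uhi]; apply: ny.
by rewrite ulo ltW.
Qed.

End generalized_lebesgue_points.

(** * Finiteness of u outside a negligible set *)

Section finiteness.
Context {R : realType} {T : pmetricType R}.
Context (mu : {outer_measure set T -> \bar R}) (s : R) (Phi : R -> R).
Context {C K : R} (G : growth_function R Phi C K).
Notation cmu := (cara_measure mu).
Notation cT := (caratheodory_type mu).
Notation small := (small mu s Phi).
Notation negligible_cap := (negligible_cap mu s Phi).
Notation energy := (energy mu Phi).
Hypothesis (mu_regular : borel_regular mu).
Hypothesis (mu_balls : balls_pos_finite mu).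
Hypothesis (mu_doubling : doubling_measure mu).
Hypothesis (s_gt0 : 0 < s) (s_le1 : s <= 1).
Context (u g : T -> \bar R).
Hypothesis (u_L0 : L0 mu u).
Hypothesis (g_meas : measurable_fun setT (g : cT -> \bar R)).
Hypothesis (g_ge0 : forall x, (0 <= g x)%E).
Hypothesis (g_energy : (energy g < +oo)%E).
Hypothesis (g_fin : forall x, (g x < +oo)%E -> u x \is a fin_num).
Hypothesis (g_grad : forall x y (a b : R), (g x <= a%:E)%E -> (g y <= b%:E)%E ->
      `|fine (u x) - fine (u y)| <= mdist x y `^ s * (a + b)).

Let mau : measurable_fun setT ((fun x => `|u x|%E) : cT -> \bar R).
Proof. by apply: measurableT_comp => //; case: u_L0. Qed.

Let high (x0 : T) (r N : R) : set T :=
  ball x0 (2 * r) `&` [set x | (N%:E < `|u x|)%E].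

Let m_high x0 r N : measurable (high x0 r N : set cT).
Proof.
apply: measurableI; first exact: (measurable_metric_ball mu mu_regular).
by rewrite -[X in measurable X]setTI; exact: emeasurable_fun_o_infty.
Qed.

(** Equal to 1 where |u| >= 2 N in B (x0, r), and to 0 outside B (x0, 2 r) and
    where |u| <= N. The spatial cutoff is needed because u itself need not be in
    the Orlicz space. *)
Let excess (x0 : T) (r N : R) (x : T) : R :=
  Num.min (cutoff x0 r x) (eclamp ((N^-1)%:E * `|u x| - 1)%E).

Lemma excess_test x0 r N : 1 <= r -> 0 < N ->
  test_pair mu s (excess x0 r N)
    (fun x => maxe ((N^-1)%:E * g x) (\1_(high x0 r N) x)%:E)%E.
Proof.
move=> r1 N0; have r0 : 0 < r by lra.
set v := excess x0 r N; set h := (fun x => _).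
have v0 x : 0 <= v x by rewrite le_min cutoff_ge0 eclamp_ge0.
have v1 x : v x <= 1 by rewrite ge_min cutoff_le1.
have h0 x : (0 <= h x)%E by rewrite /h le_max lee_fin indicE ler0n orbT.
have supp x : 0 < v x -> high x0 r N x.
  rewrite lt_min => /andP[/(cutoff_supp _ _ _ r0) xb cl]; split => //=.
  rewrite ltNge; apply/negP => uN; move: cl; rewrite ltNge => /negP; apply.
  have ufin : `|u x|%E \is a fin_num.
    by rewrite ge0_fin_numE// (le_lt_trans uN) ?ltry.
  move: uN; rewrite -(fineK ufin) lee_fin => uN.
  rewrite -EFinM -EFinB eclamp_fin//= ge_max lexx/= ge_min; apply/orP; right.
  by rewrite subr_le0 mulrC ler_pdivrMr// mul1r.
have gN x (a : R) : (h x <= a%:E)%E -> (g x <= (N * a)%:E)%E.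
  by rewrite ge_max => /andP[+ _]; rewrite lee_pdivrMl.
have hS x (a : R) : 0 < v x -> (h x <= a%:E)%E -> 1 <= a.
  move=> /supp xS; rewrite ge_max => /andP[_].
  by rewrite indicE mem_set// lee_fin.
have a0 x (a : R) : (h x <= a%:E)%E -> 0 <= a.
  by move=> ha; rewrite -lee_fin (le_trans (h0 x)).
split => //.
- apply: measurable_minr; first exact: (measurable_cutoff mu mu_regular).
  apply: measurable_eclamp; apply: emeasurable_funB; last exact: measurable_cst.
  by apply: emeasurable_funM => //; exact: measurable_cst.
- apply: measurable_maxe; first by apply: emeasurable_funM.
  exact/measurable_EFinP/measurable_indic.
- move=> x a ha; have [vx|vx] := ltP 0 (v x).
    exact: le_trans (v1 x) (hS _ _ vx ha).
  exact: le_trans vx (a0 _ _ ha).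
- move=> x y a b ha hb.
  have d0 : 0 <= mdist x y `^ s by exact: powR_ge0.
  have b0 := a0 _ _ hb.
  have [vx|vx] := ltP 0 (v x); last first.
    apply: le_trans vx _; rewrite addr_ge0// mulr_ge0// addr_ge0//.
    exact: a0 ha.
  have a1 := hS _ _ vx ha.
  have gx := gN _ _ ha; have gy := gN _ _ hb.
  have ux : u x \is a fin_num by apply: g_fin; apply: le_lt_trans gx (ltry _).
  have uy : u y \is a fin_num by apply: g_fin; apply: le_lt_trans gy (ltry _).
  have := g_grad _ _ _ _ gx gy.
  have cut := cutoff_holder s x0 r x y s_gt0 s_le1 r0.
  have cut' : cutoff x0 r x <= cutoff x0 r y + mdist x y `^ s * (a + b).
    apply: le_trans cut _; rewrite lerD2l; apply: ler_wpM2l => //.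
    apply: (@le_trans _ _ 1); last by lra.
    rewrite powRN invf_le1 ?powR_gt0//.
    have : 1 `^ s <= r `^ s by rewrite ge0_ler_powR// ?nnegrE// ltW.
    by rewrite powR1.
  rewrite -mulrDr mulrCA; set P := _ * (a + b) in cut' *.
  move=> Hg.
  rewrite /v /excess addr_minl le_min !ge_min cut'/=; apply/orP; right.
  have Ni0 : 0 < N^-1 by rewrite invr_gt0.
  move: ux uy Hg; case: (u x) => // p _; case: (u y) => // q _ /= Hg.
  rewrite !eclamp_fin//=; apply: le_trans (clamp_lip _ (N^-1 * `|q| - 1)) _.
  rewrite lerD2l (_ : _ - _ = N^-1 * (`|p| - `|q|)); last by ring.
  rewrite normrM gtr0_norm// ler_pdivrMl//.
  by apply: le_trans Hg; exact: ler_dist_dist.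
Qed.

Let high_null x0 r : 0 < r ->
  (fun k : nat => mu (high x0 r (K ^+ k))) @ \oo --> 0%E.
Proof.
move=> r0; have K2 := growth_factor_ge2 _ _ _ _ G.
have K1 : 1 <= K by lra.
have K0 : 0 < K by lra.
have [_ [A [mA A0 finA]]] := u_L0.
have nul : mu (\bigcap_k high x0 r (K ^+ k)) = 0%E.
  apply/eqP; rewrite eq_le outer_measure_ge0 andbT -[leRHS]A0.
  apply: le_outer_measure => x Hx; apply: finA => /= ufin.
  have [k kn] := archi_lt (fine `|u x|%E).
  have [_] := Hx k Logic.I; apply/negP; rewrite -leNgt.
  rewrite -(fineK (_ : `|u x|%E \is a fin_num)) ?abse_fin_num// lee_fin.
  rewrite (le_trans (ltW kn))// (le_trans (natr_le_exp2 k))//.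
  by rewrite lerXn2r// ?nnegrE// ltW.
rewrite -nul; apply: (@nonincreasing_cvg_mu _ cT R cmu).
- apply: (@le_lt_trans _ _ (mu (ball x0 (2 * r)))).
    by apply: le_outer_measure => x [].
  by have /andP[] := mu_balls x0 (2 * r) (mulr_gt0 (ltr0n _ 2) r0).
- by move=> k; exact: m_high.
- by apply: bigcap_measurable => // k _; exact: m_high.
- move=> m n mn; apply/subsetPset => x [xb xn]; split => //.
  by apply: le_lt_trans xn; rewrite lee_fin ler_weXn2l.
Qed.

(** Near a quasi-regular point x with |u x| = +oo one has |u| >= 2 N outside E, so
    the excess over N equals 1 on half of every small ball; its gradient has
    arbitrarily small energy as N grows, and [small_density] applies. *)
Lemma infinite_negligible :
  negligible_cap [set x | u x \isn't a fin_num /\ quasi_regular mu u 2^-1 x].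
Proof.
have K2 := growth_factor_ge2 _ _ _ _ G.
have K1 : 1 <= K by lra.
have K0 : 0 < K by lra.
have half0 : 0 < 2^-1 :> R by [].
have [M M0 HM] := small_density mu s Phi G mu_regular mu_balls mu_doubling
  s_gt0 s_le1 _ half0.
pose x0 : T := point.
have P1 : 0 < Phi 1 by apply: (growth_pos _ _ _ _ G).
(* The excess lives in a ball, so u is treated in one ball at a time. *)
apply: (negligible_cap_sub mu s Phi _ (\bigcup_n [set x |
    [/\ ball x0 n.+1%:R x, u x \isn't a fin_num & quasi_regular mu u 2^-1 x]])).
  move=> x [ux qx]; have [n nx] := archi_lt (mdist x0 x).
  exists n => //; split => //; rewrite mem_ball (lt_le_trans nx)//.
  by rewrite ler_nat.
apply: (negligible_cap_bigcup mu s Phi G) => n d d0.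
set r : R := n.+1%:R; have r1 : 1 <= r by rewrite ler1n.
have r0 : 0 < r by rewrite ltr0n.
have efin : energy g \is a fin_num.
  by rewrite ge0_fin_numE// (energy_ge0 mu Phi G).
set e := fine (energy g).
have e0 : 0 <= e by rewrite fine_ge0// (energy_ge0 mu Phi G).
pose a := d / (2 * M).
have a0 : 0 < a by rewrite divr_gt0// mulr_gt0.
pose a' := a / Phi 1; have a'0 : 0 < a' by rewrite divr_gt0.
have [k [ek muk]] : exists k, 2 ^- k * e <= a /\
    (mu (high x0 r (K ^+ k)) <= a'%:E)%E.
  have /fine_cvgP[Hfin /cvgrPdist_le/(_ _ a'0)[k1 _ Hk1]] := high_null x0 r r0.
  case: Hfin => k2 _ Hk2.
  have [k3 k3e] := archi_lt (e / a).
  pose k := (maxn k1 (maxn k2 k3)); exists k; split.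
    rewrite mulrC ler_pdivrMr ?exprn_gt0// mulrC -ler_pdivrMr//.
    apply: le_trans (ltW k3e) _; apply: le_trans (natr_le_exp2 k).
    by rewrite ler_nat !leq_max leqnn !orbT.
  have kf := Hk2 k; rewrite /= in kf.
  rewrite -(fineK (kf _)); last by rewrite !leq_max leqnn orbT.
  have := Hk1 k; rewrite /= sub0r normrN => /(_ _)/(le_trans (ler_norm _)).
  by rewrite lee_fin; apply; rewrite leq_max leqnn.
have Kk0 : 0 < K ^+ k by rewrite exprn_gt0.
have tp := excess_test x0 r _ r1 Kk0.
set v := excess _ _ _ in tp; set h := (fun x : T => maxe _ _) in tp.
have S0 x : (0 <= (\1_(high x0 r (K ^+ k)) x)%:E :> \bar R)%E.
  by rewrite lee_fin indicE ler0n.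
have mS : measurable_fun setT
    ((fun x => (\1_(high x0 r (K ^+ k)) x)%:E) : cT -> \bar R).
  exact/measurable_EFinP/measurable_indic.
have Kg0 x : (0 <= (K ^- k)%:E * g x)%E.
  by rewrite mule_ge0// lee_fin ltW// invr_gt0.
have mKg : measurable_fun setT ((fun x => (K ^- k)%:E * g x)%E : cT -> \bar R).
  by apply: emeasurable_funM.
have e1 : (energy (fun x => (K ^- k)%:E * g x) <= a%:E)%E.
  have := energy_half mu Phi G k _ Kg0 mKg.
  have -> : (fun x => (K ^+ k)%:E * ((K ^- k)%:E * g x))%E = g.
    by apply/funext => x; rewrite muleA -EFinM divff ?gt_eqF// mul1e.
  rewrite -lee_pdivlMl ?exprn_gt0// => /le_trans; apply.
  by rewrite -(fineK efin) -EFinM lee_fin.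
have e2 : (energy (fun x => (\1_(high x0 r (K ^+ k)) x)%:E) <= a%:E)%E.
  rewrite /energy; under eq_integral => y _.
    have -> : Phi_ext Phi (\1_(high x0 r (K ^+ k)) y)%:E =
        ((Phi 1)%:E * (\1_(high x0 r (K ^+ k)) y)%:E)%E.
      rewrite indicE; case: (y \in _); rewrite /= ?mule1//.
      by rewrite mule0 (growth_zero _ _ _ _ G).
    over.
  rewrite ge0_integralZl_EFin//; last exact: ltW.
  rewrite integral_indic// setIT muleC -lee_pdivlMr//.
have eh : (energy h <= (2 * a)%:E)%E.
  apply: le_trans (energy_max mu Phi G _ _ Kg0 S0 mKg mS) _.
  by apply: le_trans (leeD e1 e2) _; rewrite -EFinD lee_fin; lra.
apply: small_le (HM _ _ tp (le_lt_trans eh (ltry _))).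
  apply: (@le_trans _ _ (M%:E * (2 * a)%:E)%E).
    by apply: lee_wpmul2l => //; rewrite lee_fin ltW.
  by rewrite -EFinM lee_fin /a (_ : M * _ = d)//; field; rewrite gt_eqF.
move=> x [xb nux [E [cE nEx HE]]] /=.
have nV : nbhs (u x) [set z | ((2 * K ^+ k)%:E < `|z|)%E].
  move: nux; case: (u x) => // _.
    apply: filterS (nbhs_open_ereal_pinfty (2 * K ^+ k)) => z /= zz.
    by apply: lt_le_trans zz _; exact: lee_abs.
  apply: filterS (nbhs_open_ereal_ninfty (- (2 * K ^+ k))) => z /= zz.
  rewrite -abseN; apply: lt_le_trans (lee_abs _).
  by rewrite lteNr -EFinN.
have [t t0 Ht] := within_ball u _ _ _ cE nEx nV.
move: xb; rewrite mem_ball => xb.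
exists (Num.min 1 (Num.min t (r - mdist x0 x))); set q := Num.min _ _.
have q0 : 0 < q by rewrite !lt_min ltr01 t0 subr_gt0.
have q1 : q <= 1 by rewrite ge_min lexx.
have qt : q <= t by rewrite !ge_min lexx orbT.
have qr : q <= r - mdist x0 x by rewrite !ge_min lexx !orbT.
split => //.
have sub : ball x q `<=` (E `&` ball x q) `|` ([set y | v y = 1] `&` ball x q).
  move=> y xy; have [Ey|nEy] := pselect (E y); [by left|right; split => //=].
  have yr : ball x0 r y by apply: sub_ball xy; rewrite addrC -lerBrDr.
  have ub := Ht y (le_ball qt xy) nEy.
  rewrite /v /excess cutoff1// eclamp_ge1 ?minxx//.
  rewrite leeBrDr// lee_pdivlMl//.
  by apply: le_trans (ltW ub); rewrite -EFinD -EFinM lee_fin mulrC.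
have /andP[B0 Boo] := mu_balls x q q0.
have Bfin : mu (ball x q) \is a fin_num by rewrite ge0_fin_numE// ltW.
rewrite leNgt; apply/negP => H.
have := le_trans (le_outer_measure mu _ _ sub) (outer_measureU2 mu _ _).
rewrite leNgt => /negP; apply.
apply: lt_le_trans (lteD (HE q q0 q1) H) _.
by rewrite -(fineK Bfin) -!EFinM -EFinD lee_fin; lra.
Qed.

End finiteness.

(** * Concentration of the energy of a gradient *)

Section energy_concentration.
Context {R : realType} {T : pmetricType R}.
Context (mu : {outer_measure set T -> \bar R}) (s : R) (Phi : R -> R).
Context {C K : R} (G : growth_function R Phi C K).
Notation cmu := (cara_measure mu).
Notation cT := (caratheodory_type mu).
Notation negligible_cap := (negligible_cap mu s Phi).
Notation energy := (energy mu Phi).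
Hypothesis (mu_regular : borel_regular mu).
Hypothesis (mu_balls : balls_pos_finite mu).
Hypothesis (mu_doubling : doubling_measure mu).
Hypothesis (s_gt0 : 0 < s) (s_le1 : s <= 1).
Context (g : T -> \bar R).
Hypothesis (g_meas : measurable_fun setT (g : cT -> \bar R)).
Hypothesis (g_ge0 : forall x, (0 <= g x)%E).
Hypothesis (g_energy : (energy g < +oo)%E).

Let P x := Phi_ext Phi (g x).

Let mP : measurable_fun setT (P : cT -> \bar R).
Proof. exact: (measurable_energy mu Phi G). Qed.

Let P0 x : (0 <= P x)%E. Proof. exact: (Phi_ext_ge0 G). Qed.

Let intP : cmu.-integrable setT P.
Proof.
by apply/integrableP; split => //; under eq_integral do rewrite gee0_abs//.
Qed.

Lemma energy_ae_fin : {ae cmu, forall x, g x \is a fin_num}.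
Proof.
have := integrable_ae measurableT intP; apply: filterS => x /(_ Logic.I).
by rewrite /P; move: (g_ge0 x); case: (g x).
Qed.

Let tail (n : nat) (x : T) : \bar R :=
  (P x * (\1_[set y | (n%:R%:E < g y)%E] x)%:E)%E.

Let mlevel (n : nat) : measurable ([set y | (n%:R%:E < g y)%E] : set cT).
Proof. by rewrite -[X in measurable X]setTI; exact: emeasurable_fun_o_infty. Qed.

Let mtail n : measurable_fun setT (tail n : cT -> \bar R).
Proof.
by apply: emeasurable_funM => //; exact/measurable_EFinP/measurable_indic.
Qed.

Let tail0 n x : (0 <= tail n x)%E.
Proof. by rewrite mule_ge0// lee_fin indicE ler0n. Qed.

Let tail_small (e : R) : 0 < e -> exists n, (\int[cmu]_x tail n x <= e%:E)%E.
Proof.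
move=> e0.
have conv x : g x \is a fin_num -> tail ^~ x @ \oo --> 0%E.
  move=> gx; apply: cvg_near_cst.
  have [k kg] := archi_lt (fine (g x)).
  exists k => // n /= kn; rewrite /tail indicE memNset ?mule0//= -(fineK gx).
  by apply/negP; rewrite -leNgt lee_fin (le_trans (ltW kg))// ler_nat.
have [||_ _] := @dominated_convergence _ cT R cmu setT measurableT tail
    (cst 0%E) P mtail (measurable_cst _) _ intP _.
- apply: (filterS (F := almost_everywhere cmu) _ energy_ae_fin) => x gx _.
  exact: conv.
- apply: aeW => x n _; rewrite gee0_abs//.
  by rewrite /tail indicE; case: (_ \in _); rewrite ?mule1// mule0.
rewrite integral0 => /fine_cvgP[[k1 _ Hk1] /cvgrPdist_le/(_ _ e0)[k2 _ Hk2]].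
exists (maxn k1 k2); have := Hk1 (maxn k1 k2) (leq_maxl _ _).
rewrite /= => /fineK <-; rewrite lee_fin.
have := Hk2 (maxn k1 k2) (leq_maxr _ _).
by rewrite /= sub0r normrN; apply: le_trans; exact: ler_norm.
Qed.

(** For r small, Phi (n) <= Phi (l r^-s) / 2, so the part of the integral of
    Phi (g) where g <= n is absorbed. The bad balls therefore satisfy the
    hypothesis of [small_bigcup_balls] with Phi (g) restricted to {g > n}, whose
    integral tends to 0 as n grows. *)
Lemma energy_concentration_negligible (l : R) : 0 < l ->
  negligible_cap [set x | forall d, 0 < d -> exists r, [/\ 0 < r, r < d &
    ((Phi (l * r `^ (- s)))%:E * mu (ball x r) <
     \int[cmu]_(y in ball x r) Phi_ext Phi (g y))%E]].
Proof.
move=> l0 e e0.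
have [M M0 HM] := small_bigcup_balls mu s Phi G mu_regular mu_balls mu_doubling
  s_gt0 s_le1.
have li0 : 0 <= l^-1 by rewrite invr_ge0 ltW.
have [D D1 HD] := growth_scale G _ li0.
have D0 : 0 < D by exact: lt_le_trans D1.
pose q := e / (M * (2 * D)).
have q0 : 0 < q by rewrite divr_gt0// !mulr_gt0.
have [n Hn] := tail_small q q0.
(* d is chosen so that r < d forces l r^-s >= t. *)
have [t t0 Ht] := growth_unbounded G (2 * Phi n%:R).
pose d := Num.min 1 ((t / l) `^ (- s^-1)).
have tl0 : 0 < t / l by rewrite divr_gt0.
have d0 : 0 < d by rewrite lt_min ltr01 powR_gt0.
have Hd r : 0 < r -> r < d -> t <= l * r `^ (- s).
  move=> r0; rewrite lt_min => /andP[_ rd].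
  rewrite mulrC -ler_pdivrMr//.
  have -> : t / l = ((t / l) `^ (- s^-1)) `^ (- s).
    by rewrite -powRrM mulrNN mulVf ?gt_eqF// powRr1// ltW.
  rewrite !powRN lef_pV2 ?posrE ?powR_gt0 ?invr_gt0 ?powR_gt0//.
  apply: ge0_ler_powR; rewrite ?nnegrE ?(ltW s_gt0) ?(ltW r0)//.
    by rewrite invr_ge0 powR_ge0.
  by move: (ltW rd); rewrite powRN.
pose F := [set p : T * R | [/\ 0 < p.2, p.2 < d &
  ((Phi (l * p.2 `^ (- s)))%:E * mu (ball p.1 p.2) <
     \int[cmu]_(y in ball p.1 p.2) P y)%E]].
have : small mu s Phi ((M * (2 * D))%:E * \int[cmu]_x tail n x)%E
    (\bigcup_(p in F) ball p.1 p.2).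
  apply: HM => //.
  - by move=> p [p0 pd _]; rewrite p0/= ltW// (lt_le_trans pd)// ge_min lexx.
  - by rewrite mulr_ge0// ltW.
  - by apply: le_lt_trans Hn (ltry _).
  move=> [x r] [/= r0 rd HP].
  have mB : measurable (ball x r : set cT).
    exact: (measurable_metric_ball mu mu_regular).
  have /andP[B0 Boo] := mu_balls x r r0.
  have Bfin : mu (ball x r) \is a fin_num by rewrite ge0_fin_numE// ltW.
  set b := l * r `^ (- s).
  have b0 : 0 < b by rewrite mulr_gt0// powR_gt0.
  have Phib0 : 0 <= Phi b by rewrite (growth_ge0 G)// ltW.
  have split_le : (\int[cmu]_(y in ball x r) P y <=
      (Phi n%:R)%:E * mu (ball x r) + \int[cmu]_(y in ball x r) tail n y)%E.
    rewrite -(integral_cst cmu mB) -ge0_integralD//; last 2 first.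
    - by move=> y _; rewrite lee_fin (growth_ge0 G).
    - exact: measurable_funTS.
    apply: ge0_le_integral => //.
    - exact: measurable_funTS.
    - by apply: emeasurable_funD => //; exact: measurable_funTS.
    - move=> y _; rewrite /tail indicE /cst; case: (boolP (y \in _)) => yn.
        by rewrite mule1 leeDr// lee_fin (growth_ge0 G).
      rewrite mule0 adde0.
      apply: (le_Phi_ext G (g y) n%:R%:E) => //.
      by rewrite leNgt; apply/negP => h; move/negP: yn; apply; rewrite inE.
  have half : ((Phi b)%:E * mu (ball x r) <=
      2%:E * \int[cmu]_(y in ball x r) tail n y)%E.
    have Phint : 2 * Phi n%:R <= Phi b.
      apply: le_trans Ht _; apply: (growth_mono _ _ _ _ G); first exact: ltW.
      exact: Hd.
    have := lt_le_trans HP split_le.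
    have : (0 <= \int[cmu]_(y in ball x r) tail n y)%E by exact: integral_ge0.
    case: (\int[cmu]_(y in ball x r) tail n y)%E => [I| |]// I0; last first.
      by move=> _; rewrite gt0_muley ?leey// lte_fin.
    rewrite -(fineK Bfin) -!EFinM -EFinD lte_fin lee_fin.
    have : 0 < fine (mu (ball x r)) by rewrite fine_gt0// B0.
    set m := fine _ => m0.
    have := ler_wpM2r (ltW m0) Phint; rewrite -mulrA; lra.
  have rb : r `^ (- s) = l^-1 * b by rewrite /b mulKf ?gt_eqF.
  rewrite rb (mulrC 2) EFinM -muleA.
  apply: le_trans (lee_wpmul2l _ half); last by rewrite lee_fin ltW.
  rewrite muleA -EFinM; apply: lee_wpmul2r; first exact: ltW.
  by rewrite lee_fin HD// ltW.
apply: small_le.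
  apply: le_trans (lee_wpmul2l _ Hn) _; first by rewrite lee_fin ltW// !mulr_gt0.
  by rewrite -EFinM lee_fin /q mulrC divfK// gt_eqF// !mulr_gt0.
move=> x /(_ d d0)[r [r0 rd HP]]; exists (x, r) => //.
exact: mem_ball_center.
Qed.

End energy_concentration.

(** * Chaining across the level sets of a gradient *)

Lemma nneseries_geometric_le {R : realType} (a q : R) : 0 <= a -> 0 < q -> q < 1 ->
  (\sum_(0 <= j <oo) (a * q ^+ j)%:E <= (a / (1 - q))%:E)%E.
Proof.
move=> a0 q0 q1; apply: lime_le.
  by apply: is_cvg_nneseries => n _ _; rewrite lee_fin mulr_ge0// exprn_ge0// ltW.
apply: nearW => n; rewrite sumEFin lee_fin.
by have := @geometric_le_lim R n a q a0 q0; rewrite gtr0_norm//; apply.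
Qed.

Lemma powR2_gt1 {R : realType} (p : R) : 0 < p -> 1 < 2 `^ p.
Proof.
move=> p0; have : 1 `^ p < 2 `^ p :> R.
  by rewrite gt0_ltr_powR ?nnegrE// ltr1n.
by rewrite powR1.
Qed.

Lemma powRX {R : realType} (a p : R) k : 0 <= a -> (a ^+ k) `^ p = (a `^ p) ^+ k.
Proof.
move=> a0; elim: k => [|k IH]; first by rewrite !expr0 powR1.
by rewrite !exprS powRM ?exprn_ge0// IH.
Qed.

Section chaining.
Context {R : realType} {T : pmetricType R}.
Context (mu : {outer_measure set T -> \bar R}) (s c Q b : R).
Notation cmu := (cara_measure mu).
Notation cT := (caratheodory_type mu).
Hypothesis (mu_regular : borel_regular mu).
Hypothesis (mu_balls : balls_pos_finite mu).
Hypothesis (c_gt0 : 0 < c) (Q_gt0 : 0 < Q) (b_gt0 : 0 < b).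
Hypothesis (s_gt0 : 0 < s) (s_le1 : s <= 1).
Hypothesis (mu_lower : forall (x y : T) (r r' : R),
  0 < r -> r <= r' -> ball x r' y ->
  ((c * (r / r') `^ Q)%:E <= mu (ball y r) / mu (ball x r'))%E).
Context (u g : T -> \bar R).
Hypothesis (u_meas : measurable_fun setT (u : cT -> \bar R)).
Hypothesis (g_meas : measurable_fun setT (g : cT -> \bar R)).
Hypothesis (g_fin : forall x, (g x < +oo)%E -> u x \is a fin_num).
Hypothesis (g_grad : forall x y (a b : R), (g x <= a%:E)%E -> (g y <= b%:E)%E ->
      `|fine (u x) - fine (u y)| <= mdist x y `^ s * (a + b)).

Lemma ball_mass_lower (x y : T) (r r' : R) :
  0 < r -> r <= r' -> ball x r' y ->
  ((c * (r / r') `^ Q)%:E * mu (ball x r') <= mu (ball y r))%E.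
Proof.
move=> r0 rr xy; have := mu_lower _ _ _ _ r0 rr xy.
have /andP[B0 Boo] := mu_balls x r' (lt_le_trans r0 rr).
have Bfin : mu (ball x r') \is a fin_num by rewrite ge0_fin_numE// ltW.
have m0 : 0 < fine (mu (ball x r')) by rewrite fine_gt0// B0.
by rewrite -(fineK Bfin) inver gt_eqF// lee_pdivlMr.
Qed.

Let th : R := 2 `^ (- (b / Q)).
Let kap : R := 2 * th `^ s.
Let dec : R := 2 `^ (- b).

Let th0 : 0 < th. Proof. by rewrite powR_gt0. Qed.

Let th1 : th < 1.
Proof.
rewrite /th powRN invf_lt1 ?powR_gt0//.
by rewrite powR2_gt1// divr_gt0.
Qed.

Let thQ : th `^ Q = dec.
Proof. by rewrite -powRrM mulNr divfK// gt_eqF. Qed.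

Let dec0 : 0 < dec. Proof. by rewrite powR_gt0. Qed.
Let kap0 : 0 < kap. Proof. by rewrite mulr_gt0// powR_gt0. Qed.

(** The share of B (x, r) that the lower mass bound gives to a ball of radius
    r (1 - th) / 2 centred in it. At step k of the chain the radius carries the
    factor th^k and the share the factor th^(k Q) = 2^(- k b), which is the rate
    at which the level sets of g are assumed to decay. *)
Definition chain_gap : R := c * ((1 - th) / 2) `^ Q.

Lemma chain_gap_gt0 : 0 < chain_gap.
Proof. by rewrite mulr_gt0// powR_gt0// divr_gt0// subr_gt0. Qed.

Section one_ball.
Context (x z : T) (r M e : R).
Hypothesis (r_gt0 : 0 < r) (M_gt0 : 0 < M).
Hypothesis (e_lt : e < chain_gap) (e_le1 : e <= 1).
Hypothesis (levels : forall k : nat,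
  (mu (ball x r `&` [set y | ((M * 2 ^+ k)%:E < g y)%E]) <=
   (e * dec ^+ k)%:E * mu (ball x r))%E).
Hypothesis (xz : ball x r z) (gz : (g z <= M%:E)%E).

(** If y lies in level k + 1, then the ball around y of radius
    r (1 - th) th^k / 2 is too heavy to consist of points above level k, so it
    contains a point of level k, to which the induction hypothesis applies. The
    radii r (1 + th^k) / 2 leave exactly this much room. *)
Lemma chain_bound k y : ball x (r / 2 * (1 + th ^+ k)) y ->
  (g y <= (M * 2 ^+ k)%:E)%E ->
  `|fine (u y) - fine (u z)| <=
    4 * M * r `^ s * (1 + \sum_(j < k) kap ^+ j).
Proof.
have rs0 : 0 < r `^ s by rewrite powR_gt0.
elim: k y => [|k IH] y.
  rewrite !expr0 big_ord0 addr0 !mulr1 => xy gy.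
  have xy' : ball x r y by move: xy; rewrite (_ : r / 2 * (1 + 1) = r)//; field.
  have := g_grad _ _ _ _ gy gz => /le_trans; apply.
  have dyz : mdist y z <= 2 * r.
    move: xy' xz; rewrite !mem_ball => h1 h2.
    by have := metric_triangle y x z; rewrite (metric_sym y x); lra.
  have ds : mdist y z `^ s <= 2 * r `^ s.
    apply: (@le_trans _ _ ((2 * r) `^ s)).
      by apply: ge0_ler_powR; rewrite ?nnegrE ?mdist_ge0 ?mulr_ge0// ltW.
    rewrite powRM ?(ltW r_gt0)//; apply: ler_wpM2r; first exact: ltW.
    by rewrite -[leRHS]powRr1// ler_powR// ler1n.
  have := ler_wpM2r (_ : 0 <= M + M) ds; rewrite addr_ge0 ?(ltW M_gt0)//.
  by move=> /(_ isT); rewrite mulrDr; lra.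
move=> xy gy.
have thk0 : 0 < th ^+ k by rewrite exprn_gt0.
have thk1 : th ^+ k <= 1 by rewrite exprn_ile1// ltW.
pose q := (1 - th) / 2 * th ^+ k; pose rho := q * r.
have q0 : 0 < q by rewrite mulr_gt0// divr_gt0// subr_gt0.
have q_le : q <= th ^+ k.
  by rewrite /q ler_piMl ?(ltW thk0)// ler_pdivrMr// mul1r; have := th0; lra.
have rho0 : 0 < rho by rewrite mulr_gt0.
have rho_r : rho <= r by rewrite /rho ler_piMl ?(ltW r_gt0)// (le_trans q_le).
have step : r / 2 * (1 + th ^+ k.+1) + rho = r / 2 * (1 + th ^+ k).
  by rewrite /rho /q exprS; field.
have le_r : r / 2 * (1 + th ^+ k) <= r.
  have := ler_wpM2l (ltW r_gt0) thk1; lra.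
have subk : ball y rho `<=` ball x (r / 2 * (1 + th ^+ k)).
  apply: sub_ball; rewrite -step lerD2r.
  by move: xy; rewrite mem_ball => /ltW.
have xy' : ball x r y.
  by apply: (le_ball le_r); apply: subk; exact: mem_ball_center.
have [y' [yy' gy']] : exists y', ball y rho y' /\ (g y' <= (M * 2 ^+ k)%:E)%E.
  apply: contrapT => none.
  have sub : ball y rho `<=` ball x r `&` [set y | ((M * 2 ^+ k)%:E < g y)%E].
    move=> w yw; split; first exact: (le_ball le_r (subk _ yw)).
    by rewrite /= ltNge; apply/negP => gw; apply: none; exists w.
  have := le_trans (ball_mass_lower x y rho r rho0 rho_r xy')
    (le_trans (le_outer_measure mu _ _ sub) (levels k)).
  have /andP[B0 Boo] := mu_balls x r r_gt0.
  have Bfin : mu (ball x r) \is a fin_num by rewrite ge0_fin_numE// ltW.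
  have m0 : 0 < fine (mu (ball x r)) by rewrite fine_gt0// B0.
  rewrite -(fineK Bfin) -!EFinM lee_fin ler_pM2r//.
  have -> : rho / r = q by rewrite /rho mulfK// gt_eqF.
  rewrite /q powRM ?(ltW thk0) ?divr_ge0 ?subr_ge0 ?(ltW th1)//.
  rewrite powRX ?(ltW th0)// thQ mulrA ler_pM2r ?exprn_gt0//.
  by rewrite leNgt e_lt.
have := IH y' (subk _ yy') gy'.
have := g_grad _ _ _ _ gy gy'.
have ds : mdist y y' `^ s <= (th `^ s) ^+ k * r `^ s.
  apply: (@le_trans _ _ ((th ^+ k * r) `^ s)).
    move: yy'; rewrite mem_ball => yy'.
    apply: ge0_ler_powR;
      rewrite ?nnegrE ?mdist_ge0 ?mulr_ge0 ?(ltW thk0)//; try exact: ltW.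
    by apply: le_trans (ltW yy') _; rewrite ler_wpM2r// ltW.
  by rewrite powRM ?(ltW thk0) ?(ltW r_gt0)// powRX// ltW.
set A := \sum_(j < k) _; rewrite big_ord_recr/= -/A.
have -> : kap ^+ k = 2 ^+ k * (th `^ s) ^+ k by rewrite /kap exprMn.
have Mk0 : 0 <= M * 2 ^+ k.+1 + M * 2 ^+ k.
  by rewrite addr_ge0// mulr_ge0 ?exprn_ge0// ltW.
have := ler_wpM2r Mk0 ds; set X := _ `^ s * (_ + _); rewrite exprS.
set t := 2 ^+ k; set w := (th `^ s) ^+ k => hX h1 h2.
have := ler_distD (fine (u y')) (fine (u y)) (fine (u z)).
have pos : 0 <= M * r `^ s * (t * w).
  rewrite !mulr_ge0 ?exprn_ge0 ?powR_ge0//; exact: ltW.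
have -> : 4 * M * r `^ s * (1 + (A + t * w)) =
  4 * M * r `^ s * (1 + A) + 4 * (M * r `^ s * (t * w)) by ring.
have e3 : w * r `^ s * (M * (2 * t) + M * t) = 3 * (M * r `^ s * (t * w)) by ring.
by move: hX h1 h2; rewrite e3; lra.
Qed.

Lemma chain_bound_series y : ball x (r / 2) y -> (g y < +oo)%E -> (0 <= g y)%E ->
  (`|u y - u z| <= (4 * M * r `^ s)%:E *
    (1 + \sum_(0 <= j <oo) ((kap ^+ j)%:E *
      (\1_[set y | ((M * 2 ^+ j)%:E < g y)%E] y)%:E)))%E.
Proof.
move=> xy gy gy0; have rs0 : 0 < r `^ s by rewrite powR_gt0.
have gyf : g y \is a fin_num by rewrite ge0_fin_numE.
have ex : exists k : nat, (g y <= (M * 2 ^+ k)%:E)%E.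
  have [k kg] := archi_lt (fine (g y) / M); exists k.
  rewrite -(fineK gyf) lee_fin mulrC -ler_pdivrMr//.
  by rewrite (le_trans (ltW kg))// natr_le_exp2.
pose k := ex_minn ex.
have [gk mink] : (g y <= (M * 2 ^+ k)%:E)%E /\
    forall j, (j < k)%N -> ((M * 2 ^+ j)%:E < g y)%E.
  rewrite /k; case: ex_minnP => m gm Hm; split => // j jm.
  by rewrite ltNge; apply/negP => /Hm; rewrite leqNgt jm.
have xyk : ball x (r / 2 * (1 + th ^+ k)) y.
  apply: le_ball xy; rewrite ler_peMr ?divr_ge0 ?(ltW r_gt0)//.
  by rewrite lerDl exprn_ge0// ltW.
have uy := g_fin _ gy.
have uz := g_fin _ (le_lt_trans gz (ltry _)).
rewrite -(fineK uy) -(fineK uz) -EFinB abse_EFin.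
apply: (@le_trans _ _ (4 * M * r `^ s * (1 + \sum_(j < k) kap ^+ j))%:E).
  by rewrite lee_fin; exact: chain_bound.
rewrite EFinM; apply: lee_wpmul2l.
  by rewrite lee_fin !mulr_ge0// ltW.
rewrite EFinD; apply: leeD => //.
(* Below the minimal k every level set contains y, so the partial sums agree. *)
apply: (le_trans _ (nneseries_lim_ge k _)) => [|j _ _]; last first.
  by rewrite mule_ge0 ?lee_fin ?exprn_ge0 ?(ltW kap0)// indicE ler0n.
rewrite -sumEFin big_mkord; apply: lee_sum => j _.
by rewrite indicE mem_set ?mule1//=; exact: mink.
Qed.

Hypothesis (g_ge0 : forall y, (0 <= g y)%E).
Hypothesis (g_ae : {ae cmu, forall y, g y \is a fin_num}).
Hypothesis (q_lt1 : kap * dec < 1).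

(** On level j the term kap^j of the series is integrated against a set of measure
    at most a multiple of 2^(- j b). *)
Lemma chain_integral :
  (\int[cmu]_(y in ball x (r / 2)) `|u y - u z| <=
   (4 * M * r `^ s * (1 + (1 - kap * dec)^-1))%:E * mu (ball x r))%E.
Proof.
have rs0 : 0 < r `^ s by rewrite powR_gt0.
have L0 : 0 <= 4 * M * r `^ s by rewrite !mulr_ge0// ltW.
have mB t : measurable (ball x t : set cT).
  exact: (measurable_metric_ball mu mu_regular).
pose S j := [set y | ((M * 2 ^+ j)%:E < g y)%E].
have mS j : measurable (S j : set cT).
  by rewrite -[X in measurable X]setTI; exact: emeasurable_fun_o_infty.
pose f j y := ((kap ^+ j)%:E * (\1_(S j) y)%:E)%E.
have mf D j : measurable_fun D (f j : cT -> \bar R).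
  by apply: emeasurable_funM => //; exact/measurable_EFinP/measurable_indic.
have f0 j y : (0 <= f j y)%E.
  by rewrite mule_ge0 ?lee_fin ?exprn_ge0 ?(ltW kap0)// indicE ler0n.
have mF D : measurable_fun D ((fun y => \sum_(0 <= j <oo) f j y)%E : cT -> \bar R).
  by apply: ge0_emeasurable_sum.
have F0 y : (0 <= \sum_(0 <= j <oo) f j y)%E by exact: nneseries_ge0.
apply: (@le_trans _ _ (\int[cmu]_(y in ball x (r / 2)) ((4 * M * r `^ s)%:E *
    (1 + \sum_(0 <= j <oo) f j y)))%E).
  apply: ae_ge0_le_integral => //.
  - apply: measurableT_comp => //; apply: emeasurable_funB => //.
    exact: measurable_funTS.
  - by move=> y _; rewrite mule_ge0 ?lee_fin// adde_ge0.
  - by apply: emeasurable_funM => //; apply: emeasurable_funD.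
  - apply: (filterS (F := almost_everywhere cmu) _ g_ae) => y gy By.
    by apply: chain_bound_series => //; rewrite -ge0_fin_numE.
rewrite ge0_integralZl_EFin//; last 2 first.
- by move=> y _; rewrite adde_ge0.
- by apply: emeasurable_funD.
rewrite [X in (_ <= X * _)%E]EFinM -muleA; apply: lee_wpmul2l.
  by rewrite lee_fin.
rewrite ge0_integralD// integral_cst// mul1e integral_nneseries//.
rewrite EFinD ge0_muleDl ?lee_fin ?invr_ge0 ?subr_ge0 ?(ltW q_lt1)// mul1e.
apply: leeD.
  apply: le_outer_measure; apply: le_ball.
  by rewrite ler_pdivrMr// ler_peMr ?ler1n// ltW.
have /andP[B0 Boo] := mu_balls x r r_gt0.
have Bfin : mu (ball x r) \is a fin_num by rewrite ge0_fin_numE// ltW.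
have m0 : 0 < fine (mu (ball x r)) by rewrite fine_gt0// B0.
have kd0 : 0 < kap * dec by rewrite mulr_gt0.
have Bm := esym (fineK Bfin); move: m0 Bm; set m := fine _ => m0 Bm.
rewrite Bm -EFinM [X in (_ <= X%:E)%E]mulrC.
apply: le_trans (nneseries_geometric_le _ _ (ltW m0) kd0 q_lt1).
apply: lee_nneseries => [j _ _|j _]; first exact: integral_ge0.
rewrite ge0_integralZl_EFin//; last 2 first.
- exact/measurable_EFinP/measurable_indic.
- by rewrite exprn_ge0// ltW.
rewrite integral_indic//.
apply: (@le_trans _ _ ((kap ^+ j)%:E * ((e * dec ^+ j)%:E * mu (ball x r)))%E).
  apply: lee_wpmul2l; first by rewrite lee_fin exprn_ge0// ltW.
  apply: le_trans (levels j); apply: le_outer_measure => y [Sy By]; split => //.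
  by apply: le_ball By; rewrite ler_pdivrMr// ler_peMr ?ler1n// ltW.
rewrite Bm -!EFinM lee_fin.
have -> : (kap * dec) ^+ j = kap ^+ j * dec ^+ j by rewrite exprMn.
have : 0 <= kap ^+ j * (dec ^+ j * m) by rewrite !mulr_ge0 ?exprn_ge0// ltW.
by move=> /(ler_wpM2r) /(_ _ _ e_le1); lra.
Qed.

End one_ball.
End chaining.

(** * Lebesgue points *)

Section lebesgue_points.
Context {R : realType} {T : pmetricType R}.
Context (mu : {outer_measure set T -> \bar R}).
Notation cmu := (cara_measure mu).
Notation cT := (caratheodory_type mu).
Hypothesis (mu_regular : borel_regular mu).
Hypothesis (mu_balls : balls_pos_finite mu).
Context (u : T -> \bar R).
Hypothesis (u_meas : measurable_fun setT (u : cT -> \bar R)).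

Lemma lebesgue_point_of_mean_oscillation x : u x \is a fin_num ->
  (forall e, 0 < e -> exists2 d, 0 < d & forall r, 0 < r -> r < d ->
    (\int[cmu]_(y in ball x r) `|u y - u x| <= e%:E * mu (ball x r))%E) ->
  lebesgue_point mu u x.
Proof.
move=> ufin H.
have mB r : measurable (ball x r : set cT).
  exact: (measurable_metric_ball mu mu_regular).
have muf D : measurable_fun D (u : cT -> \bar R) by exact: measurable_funTS.
have mdiff D : measurable_fun D ((fun y => u y - u x)%E : cT -> \bar R).
  exact: emeasurable_funB.
have icst r : 0 < r -> cmu.-integrable (ball x r : set cT) (cst (u x)).
  move=> r0; have /andP[B0 Boo] := mu_balls x r r0.
  apply/integrableP; split => //.
  rewrite (integral_cst cmu (mB r)); apply: lte_mul_pinfty => //;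
    by move: ufin; case: (u x).
have idiff e r : 0 < r ->
    (\int[cmu]_(y in ball x r) `|u y - u x| <= e%:E * mu (ball x r))%E ->
    cmu.-integrable (ball x r : set cT) (fun y => u y - u x)%E.
  move=> r0 He; have /andP[B0 Boo] := mu_balls x r r0.
  apply/integrableP; split => //; apply: le_lt_trans He _.
  have Bfin : mu (ball x r) \is a fin_num by rewrite ge0_fin_numE// ltW.
  by rewrite -(fineK Bfin) -EFinM ltry.
have iu e r : 0 < r ->
    (\int[cmu]_(y in ball x r) `|u y - u x| <= e%:E * mu (ball x r))%E ->
    cmu.-integrable (ball x r : set cT) u.
  move=> r0 He.
  have := integrableD (mB r) (idiff _ _ r0 He) (icst r r0).
  by apply: eq_integrable => // y _ /=; rewrite subeK.
split.
  have [d d0 Hd] := H 1 ltr01; apply: near_right0 d0 _ => r r0 rd.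
  exact: iu (Hd r r0 rd).
rewrite -(fineK ufin); apply: cvg_right0_EFin => e e0.
have [d d0 Hd] := H e e0; exists d => // r r0 rd.
have /andP[B0 Boo] := mu_balls x r r0.
have Bfin : mu (ball x r) \is a fin_num by rewrite ge0_fin_numE// ltW.
have m0 : 0 < fine (mu (ball x r)) by rewrite fine_gt0// B0.
have Hr := Hd r r0 rd.
have Ifin : (\int[cmu]_(y in ball x r) u y)%E \is a fin_num.
  by apply: integrable_fin_num => //; exact: iu Hr.
have E : (\int[cmu]_(y in ball x r) (u y - u x) =
    \int[cmu]_(y in ball x r) u y - u x * mu (ball x r))%E.
  have := integralB (mB r) (iu _ _ r0 Hr) (icst r r0).
  by rewrite (integral_cst cmu (mB r)).
have := le_trans (le_abse_integral cmu (mB r) (mdiff _)) Hr.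
rewrite E -(fineK Bfin) -(fineK ufin) -(fineK Ifin) /=.
set m := fine (mu _) in m0 *; set I := fine (\int[_]_(_ in _) _)%E.
rewrite lee_fin inver gt_eqF// -EFinM !lee_fin => HI.
rewrite ler_pdivlMr// ler_pdivrMr//; move: HI; rewrite ler_norml => /andP[h1 h2].
by apply/andP; split; lra.
Qed.

Context (s : R) (Phi : R -> R) {C K : R} (G : growth_function R Phi C K).
Hypothesis (s_gt0 : 0 < s) (s_le1 : s <= 1).
Hypothesis (mu_doubling : doubling_measure mu).
Context (c Q : R) (c_gt0 : 0 < c) (Q_gt0 : 0 < Q).
Hypothesis (mu_lower : forall (x y : T) (r r' : R),
  0 < r -> r <= r' -> ball x r' y ->
  ((c * (r / r') `^ Q)%:E <= mu (ball y r) / mu (ball x r'))%E).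
Context (C0 b : R) (C0_ge1 : 1 <= C0) (b_gt : Q / (Q + s) < b).
Hypothesis (Phi_lower_growth : forall t t' : R, 0 < t -> t <= t' ->
  Phi t <= C0 * (t / t') `^ b * Phi t').
Context (g : T -> \bar R).
Hypothesis (g_meas : measurable_fun setT (g : cT -> \bar R)).
Hypothesis (g_ge0 : forall x, (0 <= g x)%E).
Hypothesis (g_energy : (energy mu Phi g < +oo)%E).
Hypothesis (g_fin : forall x, (g x < +oo)%E -> u x \is a fin_num).
Hypothesis (g_grad : forall x y (a b : R), (g x <= a%:E)%E -> (g y <= b%:E)%E ->
      `|fine (u x) - fine (u y)| <= mdist x y `^ s * (a + b)).

Let b_gt0 : 0 < b.
Proof. by apply: lt_trans b_gt; rewrite divr_gt0// addr_gt0. Qed.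

Let ratio_lt1 : 2 * (2 `^ (- (b / Q))) `^ s * 2 `^ (- b) < 1 :> R.
Proof.
have Qs : 0 < Q + s by exact: addr_gt0.
have -> : 2 * (2 `^ (- (b / Q))) `^ s * 2 `^ (- b) =
    2 `^ (- (b * (Q + s) / Q - 1)) :> R.
  rewrite -powRrM -[X in X * _ * _]powRr1// -!powRD ?pnatr_eq0 ?implybT//.
  by congr (_ `^ _); field; rewrite gt_eqF.
rewrite powRN invf_lt1 ?powR_gt0// powR2_gt1// subr_gt0 ltr_pdivlMr// mul1r.
by rewrite -ltr_pdivrMr.
Qed.

Let level_constant (e : R) : 0 < e -> exists2 A : R, 1 <= A & C0 * A `^ (- b) <= e.
Proof.
move=> e0; have C0p : 0 < C0 by exact: lt_le_trans C0_ge1.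
exists (Num.max 1 ((C0 / e) `^ b^-1)); first by rewrite le_max lexx.
have q0 : 0 < C0 / e by rewrite divr_gt0.
rewrite powRN -ler_pdivlMl// (_ : C0^-1 * e = (C0 / e)^-1); last first.
  by rewrite invf_div mulrC.
rewrite lef_pV2 ?posrE ?powR_gt0// ?lt_max ?ltr01//.
apply: (@le_trans _ _ (((C0 / e) `^ b^-1) `^ b)).
  by rewrite -powRrM mulVf ?gt_eqF// powRr1// ltW.
apply: ge0_ler_powR; rewrite ?nnegrE ?powR_ge0 ?(ltW b_gt0)//.
by rewrite le_max lexx orbT.
Qed.

(** The chain is run in B (x, 2 r) with levels A l (2 r)^-s 2^k. Its base point z is
    chosen where both g z is in the lowest level and u z is within e / 2 of u x:
    each condition fails on at most half of the ball, one of them on strictly less.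
    The constant A makes the levels decay as [chain_bound] requires, and l is then
    chosen so that the resulting oscillation is at most e / 2. *)
Lemma lebesgue_of_energy_decay x : u x \is a fin_num ->
  quasi_regular mu u 2^-1 x ->
  (forall l, 0 < l -> exists2 d, 0 < d & forall r, 0 < r -> r < d ->
    (\int[cmu]_(y in ball x r) Phi_ext Phi (g y) <=
     (Phi (l * r `^ (- s)))%:E * mu (ball x r))%E) ->
  lebesgue_point mu u x.
Proof.
move=> ufin qr decay; apply: lebesgue_point_of_mean_oscillation => // e e0.
pose gap := chain_gap c Q b.
have gap0 : 0 < gap by exact: chain_gap_gt0.
pose eta := Num.min (gap / 2) 2^-1.
have eta0 : 0 < eta by rewrite lt_min divr_gt0/=.
have eta_gap : eta < gap.
  by apply: (@le_lt_trans _ _ (gap / 2)); [rewrite ge_min lexx|lra].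
have eta_half : eta <= 2^-1 by rewrite ge_min lexx orbT.
have [A A1 HA] := level_constant _ eta0.
have A0 : 0 < A by exact: lt_le_trans A1.
have [Db Db1 HDb] := doubling_ball mu_doubling.
have Db0 : 0 < Db by exact: lt_le_trans Db1.
set q := 2 * (2 `^ (- (b / Q))) `^ s * 2 `^ (- b).
have q1 : q < 1 by exact: ratio_lt1.
pose L := 4 * A * (1 + (1 - q)^-1) * Db.
have L0 : 0 < L.
  by rewrite !mulr_gt0// addr_gt0// invr_gt0 subr_gt0.
pose l := e / (2 * L).
have l0 : 0 < l by rewrite divr_gt0// mulr_gt0.
have e20 : 0 < e / 2 by rewrite divr_gt0.
have [d1 d10 Hd1] := decay l l0.
have [d2 d20 Hd2] := quasi_regular_ball mu u 2^-1 (e / 2) x ufin e20 qr.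
exists (Num.min d1 d2 / 2); first by rewrite divr_gt0// lt_min d10.
move=> r r0 rd; pose r2 := 2 * r.
have r20 : 0 < r2 by rewrite mulr_gt0.
have : r2 < Num.min d1 d2 by rewrite /r2 mulrC -ltr_pdivlMr.
rewrite lt_min => /andP[r2d1 r2d2].
have mB t : measurable (ball x t : set cT).
  exact: (measurable_metric_ball mu mu_regular).
have /andP[B0 Boo] := mu_balls x r2 r20.
have Bfin : mu (ball x r2) \is a fin_num by rewrite ge0_fin_numE// ltW.
have Bm := esym (fineK Bfin).
have m0 : 0 < fine (mu (ball x r2)) by rewrite fine_gt0// B0.
move: m0 Bm; set m := fine _ => m0 Bm.
pose t := l * r2 `^ (- s).
have t0 : 0 < t by rewrite mulr_gt0// powR_gt0.
pose M := A * t; have M0 : 0 < M by rewrite mulr_gt0.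
have en := Hd1 _ r20 r2d1; rewrite -/t in en.
have levels k : (mu (ball x r2 `&` [set y | ((M * 2 ^+ k)%:E < g y)%E]) <=
   (eta * (2 `^ (- b)) ^+ k)%:E * mu (ball x r2))%E.
  set S := _ `&` _.
  have mS : measurable (S : set cT).
    apply: measurableI => //.
    by rewrite -[X in measurable X]setTI; exact: emeasurable_fun_o_infty.
  have Mk0 : 0 < M * 2 ^+ k by rewrite mulr_gt0// exprn_gt0.
  have P0 : 0 < Phi (M * 2 ^+ k) by exact: (growth_pos _ _ _ _ G).
  have mP : measurable_fun setT ((fun y => Phi_ext Phi (g y)) : cT -> \bar R).
    exact: (measurable_energy mu Phi G).
  (* Chebyshev's inequality for Phi (g) on the ball. *)
  have cheb : ((Phi (M * 2 ^+ k))%:E * mu S <=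
      \int[cmu]_(y in ball x r2) Phi_ext Phi (g y))%E.
    apply: (@le_trans _ _ (\int[cmu]_(y in S) Phi_ext Phi (g y))%E).
      rewrite -(integral_cst cmu mS); apply: ge0_le_integral => //.
      - by move=> y _; rewrite lee_fin ltW.
      - exact: measurable_funTS.
      - move=> y [_ /ltW gy]; apply: (le_Phi_ext G (M * 2 ^+ k)%:E) => //.
        by rewrite lee_fin ltW.
    apply: ge0_subset_integral => //.
    - exact: measurable_funTS.
    - by move=> y _; exact: (Phi_ext_ge0 G).
    - by move=> y [].
  have tM : t <= M * 2 ^+ k.
    rewrite /M mulrAC ler_peMl ?(ltW t0)//.
    by rewrite (le_trans A1)// ler_peMr ?(ltW A0)// exprn_ege1// ler1n.
  have gr := Phi_lower_growth _ _ t0 tM.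
  have Sfin : mu S \is a fin_num.
    rewrite ge0_fin_numE; last exact: outer_measure_ge0.
    by apply: le_lt_trans Boo; apply: le_outer_measure => y [].
  have := le_trans cheb en.
  rewrite -(fineK Sfin) Bm -!EFinM !lee_fin => HS.
  have : Phi (M * 2 ^+ k) * fine (mu S) <=
      Phi (M * 2 ^+ k) * (eta * (2 `^ (- b)) ^+ k * m).
    apply: le_trans HS _.
    apply: (@le_trans _ _ (C0 * (t / (M * 2 ^+ k)) `^ b * Phi (M * 2 ^+ k) * m)).
      by rewrite ler_wpM2r// ltW.
    rewrite mulrAC mulrC ler_wpM2l ?(ltW P0)// ler_wpM2r ?(ltW m0)//.
    have -> : t / (M * 2 ^+ k) = (A * 2 ^+ k)^-1.
      by rewrite /M; field; rewrite !gt_eqF// exprn_gt0.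
    have Ak0 : 0 < A * 2 ^+ k by rewrite mulr_gt0// exprn_gt0.
    have -> : (A * 2 ^+ k)^-1 `^ b = A `^ (- b) * (2 `^ (- b)) ^+ k.
      rewrite -powR_inv1 ?(ltW Ak0)// -powRrM mulN1r.
      by rewrite powRM ?(ltW A0) ?exprn_ge0// powRX.
    by rewrite mulrA ler_wpM2r// exprn_ge0// powR_ge0.
  by rewrite ler_pM2l.
have near0 := Hd2 _ r20 r2d2.
have [z [xz gz uz]] : exists z, [/\ ball x r2 z, (g z <= M%:E)%E &
    ((fine (u x) - e / 2)%:E < u z < (fine (u x) + e / 2)%:E)%E].
  apply: contrapT => none.
  have sub : ball x r2 `<=`
    (ball x r2 `&` [set y | ((M * 2 ^+ 0)%:E < g y)%E]) `|`
    (ball x r2 `&` [set y |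
       ~ ((fine (u x) - e / 2)%:E < u y < (fine (u x) + e / 2)%:E)%E]).
    move=> y xy; have [gy|gy] := leP (g y) M%:E; last first.
      by left; split => //=; rewrite expr0 mulr1.
    by right; split => //= uy; apply: none; exists y.
  have := le_trans (le_outer_measure mu _ _ sub) (outer_measureU2 mu _ _).
  rewrite leNgt => /negP; apply.
  apply: lt_le_trans (lee_ltD _ (levels 0%N) near0) _.
    rewrite ge0_fin_numE; last exact: outer_measure_ge0.
    by apply: le_lt_trans Boo; apply: le_outer_measure => y [].
  rewrite expr0 mulr1 Bm -!EFinM -EFinD lee_fin -mulrDl ler_piMl ?(ltW m0)//.
  by lra.
have uzf : u z \is a fin_num.
  by rewrite fin_numElt; have /andP[/(lt_trans (ltNyr _)) -> /lt_trans -> ] := uz;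
    rewrite ?ltry.
have g_ae := energy_ae_fin mu Phi G g g_meas g_ge0 g_energy.
have eta1 : eta <= 1 by lra.
have key := chain_integral mu s c Q b mu_regular mu_balls Q_gt0 b_gt0
  s_gt0 s_le1
  mu_lower u g u_meas g_meas g_fin g_grad x z r2 M eta r20 M0 eta_gap eta1
  levels xz gz g_ge0 g_ae ratio_lt1.
have rE : r2 / 2 = r by rewrite /r2; field.
rewrite rE -/q in key.
have Mr : M * r2 `^ s = A * l.
  rewrite /M /t powRN -!mulrA mulVf ?mulr1// gt_eqF// powR_gt0//.
have [b0' boo'] := andP (mu_balls x r r0).
have bfin : mu (ball x r) \is a fin_num by rewrite ge0_fin_numE// ltW.
have dbl : (mu (ball x r2) <= Db%:E * mu (ball x r))%E.
  apply: le_trans (HDb x r r0); apply: le_outer_measure; apply: le_ball.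
  by rewrite ler_wpM2r ?(ltW r0)// ler_nat.
have key2 : (\int[cmu]_(y in ball x r) `|u y - u z| <= (e / 2)%:E * mu (ball x r))%E.
  apply: le_trans key _.
  have -> : 4 * M * r2 `^ s = 4 * (A * l) by rewrite -mulrA Mr.
  apply: le_trans (lee_wpmul2l _ dbl) _.
    have inv0 : 0 <= 1 + (1 - q)^-1.
      by rewrite addr_ge0// invr_ge0 subr_ge0 ltW.
    by rewrite lee_fin; apply: mulr_ge0 => //; rewrite mulr_ge0// mulr_ge0// ltW.
  rewrite muleA -EFinM; apply: lee_wpmul2r; first exact: ltW.
  rewrite lee_fin (_ : _ * Db = l * L); last by rewrite /L; ring.
  by rewrite /l le_eqVlt; apply/orP; left; apply/eqP; field; rewrite gt_eqF.
apply: (@le_trans _ _ (\int[cmu]_(y in ball x r) (`|u y - u z| + (e / 2)%:E))%E).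
  apply: ge0_le_integral => //.
  - apply: measurableT_comp => //; apply: emeasurable_funB => //.
    exact: measurable_funTS.
  - apply: emeasurable_funD => //; apply: measurableT_comp => //.
    by apply: emeasurable_funB => //; exact: measurable_funTS.
  - move=> y _; move: uz ufin uzf; case: (u x) => // ux; case: (u z) => // v.
    rewrite !lte_fin /= => /andP[h1 h2] _ _; case: (u y) => [w| |]//=.
    rewrite lee_fin; have := ler_distD v w ux.
    have : `|v - ux| <= e / 2 by rewrite ler_norml; apply/andP; split; lra.
    by lra.
rewrite ge0_integralD//; last 2 first.
- apply: measurableT_comp => //; apply: emeasurable_funB => //.
  exact: measurable_funTS.
- by move=> y _; rewrite lee_fin ltW.
rewrite [X in (_ + X)%E](integral_cst cmu (mB r)) [in leRHS](splitr e) EFinD.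
rewrite ge0_muleDl ?lee_fin ?(ltW e20)//; exact: leeD.
Qed.

End lebesgue_points.

(** * The theorem *)

Section assembly.
Context {R : realType}.

(** Iterated halving from t0 gives Phi 0 = 0, and iterated doubling up to t0 gives
    positivity. *)
Lemma growth_function_of (Phi : R -> R) :
  (forall t, 0 <= t -> 0 <= Phi t) ->
  {in `[0, +oo[ &, {homo Phi : x y / x <= y}} ->
  (exists C : R, forall t, 0 < t -> Phi (2 * t) <= C * Phi t) ->
  (exists2 C' : R, 1 <= C' & forall t, 0 < t -> Phi (t / C') <= Phi t / 2) ->
  (exists2 t, 0 < t & 0 < Phi t) ->
  exists C K, growth_function R Phi C K.
Proof.
move=> P0 Pinc [C HC] [C' C'1 HC'] [t0 t00 Pt0].
have Pm (x y : R) : 0 <= x -> x <= y -> Phi x <= Phi y.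
  by move=> x0 xy; apply: Pinc; rewrite ?in_itv/= ?andbT// (le_trans x0).
have C'0 : 0 < C' by exact: lt_le_trans C'1.
pose C1 := Num.max 1 C; pose K := Num.max 2 C'.
have C11 : 1 <= C1 by rewrite le_max lexx.
have C10 : 0 < C1 by exact: lt_le_trans C11.
have dbl t : 0 < t -> Phi (2 * t) <= C1 * Phi t.
  move=> tp; apply: le_trans (HC t tp) _; apply: ler_wpM2r.
    exact: P0 (ltW tp).
  by rewrite le_max lexx orbT.
have Pz : Phi 0 = 0.
  apply/eqP; rewrite eq_le P0// andbT leNgt; apply/negP => Pp.
  have it n : 2 ^+ n * Phi (t0 / C' ^+ n) <= Phi t0.
    elim: n => [|n IH]; first by rewrite !expr0 mul1r divr1.
    apply: le_trans IH; rewrite exprSr -mulrA; apply: ler_wpM2l.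
      exact: exprn_ge0.
    have := HC' (t0 / C' ^+ n) (divr_gt0 t00 (exprn_gt0 n C'0)).
    by rewrite exprSr invfM mulrA; lra.
  have [n] := archi_lt (Phi t0 / Phi 0).
  rewrite ltr_pdivrMr// ltNge => /negP; apply.
  apply: le_trans (it n); apply: ler_pM => //; first exact: ltW.
    exact: natr_le_exp2.
  by apply: Pm => //; rewrite divr_ge0 ?exprn_ge0// ltW.
have Pp t : 0 < t -> 0 < Phi t.
  move=> tp; have [n] := archi_lt (t0 / t); rewrite ltr_pdivrMr// => nt.
  have it m : Phi (2 ^+ m * t) <= C1 ^+ m * Phi t.
    elim: m => [|m IH]; first by rewrite !expr0 !mul1r.
    rewrite !exprS -!mulrA; apply: le_trans (dbl _ _) _.
      by rewrite mulr_gt0// exprn_gt0.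
    by rewrite ler_wpM2l// ltW.
  rewrite -(pmulr_rgt0 _ (exprn_gt0 n C10)); apply: lt_le_trans (it n).
  apply: lt_le_trans Pt0 _; apply: Pm; first exact: ltW.
  apply: le_trans (ltW nt) _; apply: ler_wpM2r; first exact: ltW.
  exact: natr_le_exp2.
exists C1, K; split => //.
- move=> t; rewrite le_eqVlt => /predU1P[<-|/dbl//].
  by rewrite !mulr0 Pz mulr0.
- by rewrite le_max lexx.
- move=> t; rewrite le_eqVlt => /predU1P[<-|tp].
    by rewrite mulr0 Pz mul0r.
  have K0 : 0 < K by rewrite lt_max ltr0n.
  apply: le_trans (HC' (K * t) (mulr_gt0 K0 tp)); apply: Pm; first exact: ltW.
  by rewrite mulrAC ler_peMl ?(ltW tp)// ler_pdivlMr// mul1r le_max lexx orbT.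
Qed.

(** The constant function 1 has quasinorm 0 and the gradient 0. *)
Lemma capacity_of_zero_growth {T : pmetricType R}
    (mu : {outer_measure set T -> \bar R}) (s : R) (Phi : R -> R) (A : set T) :
  (forall t, 0 <= t -> Phi t = 0) ->
  capacity mu s (orlicz_space mu Phi) (orlicz_norm mu Phi) A = 0%E.
Proof.
move=> P0.
have mod0 (r l : R) : 0 < l ->
    orlicz_modular mu Phi (cst r%:E) l = 0%E.
  move=> l0; rewrite /orlicz_modular.
  under eq_integral => x _.
    rewrite /cst /= inver gt_eqF//= P0; last first.
      by rewrite mulr_ge0// invr_ge0 ltW.
    over.
  by rewrite integral0.
have norm0 (r : R) : orlicz_norm mu Phi (cst r%:E) = 0%E.
  apply/eqP; rewrite eq_le orlicz_norm_ge0 andbT; apply/lee_addgt0Pr => e e0.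
  rewrite add0e; apply: ereal_inf_lbound; exists e => //=.
  by split => //; rewrite mod0.
apply/eqP; rewrite eq_le; apply/andP; split; last first.
  apply: le_ereal_inf_tmp => _ [v _ <-].
  by rewrite adde_ge0// ?orlicz_norm_ge0// dotM_norm_ge0.
have dn : (dotM_norm mu s (orlicz_norm mu Phi) (cst 1%E) <= 0)%E.
  apply: (@le_trans _ _ (orlicz_norm mu Phi (cst 0%:E))); last by rewrite norm0.
  apply: ereal_inf_lbound; exists (cst 0%:E) => //.
  split => //; first exact: measurable_cst.
  exists set0; first exact: outer_measure0.
  by move=> x y _ _; rewrite /cst subee// abse0 adde0 mule0.
have m1 : measurable_fun setT (cst 1%E : caratheodory_type mu -> \bar R).
  exact: measurable_cst.
have L1 : L0 mu (cst 1%E) by split => //; exact: aeW.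
apply: (@le_trans _ _ (M_norm mu s (orlicz_norm mu Phi) (cst 1%E))).
  apply: ereal_inf_lbound; exists (cst 1%E) => //; split.
    split; first by split => //; exact: le_lt_trans dn (ltry _).
    by split => //; exists 1 => //; rewrite mod0 ?ltry.
  by exists setT; split => //; exact: openT.
by rewrite /M_norm norm0 add0e.
Qed.

End assembly.

Theorem theorem7p5 (R : realType) (T : pmetricType R)
    (mu : {outer_measure set T -> \bar R})
    (mu_regular : borel_regular mu)
    (mu_balls : balls_pos_finite mu)
    (mu_doubling : doubling_measure mu)
    (c Q : R) (c_gt0 : 0 < c) (Q_gt0 : 0 < Q)
    (mu_lower : forall (x y : T) (r r' : R),
      0 < r -> r <= r' -> ball x r' y ->
      ((c * (r / r') `^ Q)%:E <= mu (ball y r) / mu (ball x r'))%E)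
    (Phi : R -> R)
    (Phi_ge0 : forall t, 0 <= t -> 0 <= Phi t)
    (Phi_continuous : {within `[0, +oo[, continuous Phi})
    (Phi_increasing : {in `[0, +oo[ &, {homo Phi : x y / x <= y}})
    (Phi_doubling : exists C : R, forall t, 0 < t -> Phi (2 * t) <= C * Phi t)
    (Phi_halving : exists2 C' : R, 1 <= C' &
      forall t, 0 < t -> Phi (t / C') <= Phi t / 2)
    (s : R) (s_gt0 : 0 < s) (s_le1 : s <= 1)
    (u : T -> \bar R)
    (u_dotM : dotM mu s (orlicz_norm mu Phi) u)
    (u_qc : quasicontinuous mu s (orlicz_space mu Phi) (orlicz_norm mu Phi) u) :
  quasieverywhere mu s (orlicz_space mu Phi) (orlicz_norm mu Phi)
    (generalized_lebesgue_point mu u) /\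
  ((exists C0 beta : R, [/\ 1 <= C0, Q / (Q + s) < beta &
      forall sigma t, 0 < sigma -> sigma <= t ->
        Phi sigma <= C0 * (sigma / t) `^ beta * Phi t]) ->
   quasieverywhere mu s (orlicz_space mu Phi) (orlicz_norm mu Phi)
     (lebesgue_point mu u)).
Proof.
have [nontriv|triv] := pselect (exists2 t, 0 < t & 0 < Phi t); last first.
  have P0 t : 0 <= t -> Phi t = 0.
    move=> t0; apply/eqP; rewrite eq_le Phi_ge0// andbT leNgt; apply/negP => Pt.
    apply: triv; exists (t + 1); first by rewrite ltr_wpDl.
    apply: lt_le_trans Pt _; apply: Phi_increasing; rewrite ?in_itv/= ?andbT//.
      by rewrite addr_ge0.
    by rewrite lerDl.
  by split => [|_]; (exists setT; [exact: capacity_of_zero_growth|move=> x []]).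
have [C [K G]] := growth_function_of Phi Phi_ge0 Phi_increasing Phi_doubling
  Phi_halving nontriv.
have qe (A : set T) (P : T -> Prop) : negligible_cap mu s Phi A ->
    (forall x, ~ A x -> P x) ->
    quasieverywhere mu s (orlicz_space mu Phi) (orlicz_norm mu Phi) P.
  by move=> nA AP; exists A => //; exact: (capacity_eq0 mu s Phi G).
have [u_L0 /ereal_inf_lt[_ [g0 ug0 <-] ng0]] := u_dotM.
have [mg0 _ _] := ug0; have [mu_ _] := u_L0.
have eg0 := energy_lty_of_norm mu Phi G g0 mg0 ng0.
have [g [mg gge0 eg gfin ggrad]] :=
  gradient_everywhere mu s Phi G mu_regular s_gt0 u g0 ug0.
have {eg} eg := le_lt_trans eg eg0.
pose bad1 := \bigcup_n [set x | ~ quasi_regular mu u n.+1%:R^-1 x].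
pose bad2 := [set x | u x \isn't a fin_num /\ quasi_regular mu u 2^-1 x].
pose bad3 := \bigcup_n [set x | forall d, 0 < d -> exists r, [/\ 0 < r, r < d &
    ((Phi (n.+1%:R^-1 * r `^ (- s)))%:E * mu (ball x r) <
     \int[cara_measure mu]_(y in ball x r) Phi_ext Phi (g y))%E]].
have n1 : negligible_cap mu s Phi bad1.
  apply: (negligible_cap_bigcup mu s Phi G) => n.
  have n0 : 0 < n.+1%:R^-1 :> R by rewrite invr_gt0 ltr0n.
  exact: (quasi_regular_qe mu s Phi G).
have n2 : negligible_cap mu s Phi bad2.
  exact: (infinite_negligible mu s Phi G mu_regular mu_balls mu_doubling
    s_gt0 s_le1 u g).
have n3 : negligible_cap mu s Phi bad3.
  apply: (negligible_cap_bigcup mu s Phi G) => n.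
  apply: (energy_concentration_negligible mu s Phi G) => //.
pose bad n := match n with 0%N => bad1 | 1%N => bad2 | _ => bad3 end.
have qr x : ~ bad1 x -> forall e, 0 < e -> quasi_regular mu u e x.
  move=> nb e e0; have [n] := ltr_add_invr e0; rewrite add0r => ne.
  apply: quasi_regular_le (ltW ne) _; apply: contrapT => nq; apply: nb.
  by exists n.
have fin x : ~ bad1 x -> ~ bad2 x -> u x \is a fin_num.
  move=> nb1 nb2; apply: contrapT => nf; apply: nb2.
  by split; [exact/negP|exact: qr].
have nbad : negligible_cap mu s Phi (\bigcup_n bad n).
  by apply: (negligible_cap_bigcup mu s Phi G) => -[|[|n]].
have nb x : ~ (\bigcup_n bad n) x -> [/\ ~ bad1 x, ~ bad2 x & ~ bad3 x].
  move=> H; split => h; apply: H; [by exists 0%N|by exists 1%N|by exists 2%N].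
split.
  apply: (qe _ _ nbad) => x /nb[nb1 nb2 _].
  apply: (generalized_lebesgue_of_quasi_regular mu mu_balls) => //.
    exact: fin.
  exact: qr.
move=> [C0 [b [C01 bQ HPhi]]]; apply: (qe _ _ nbad) => x /nb[nb1 nb2 nb3].
apply: (lebesgue_of_energy_decay mu mu_regular mu_balls u mu_ s Phi G s_gt0 s_le1
  mu_doubling c Q c_gt0 Q_gt0 mu_lower C0 b C01 bQ HPhi
  g mg gge0 eg gfin ggrad) => //.
- exact: fin.
- exact: qr.
move=> l l0; have [n] := ltr_add_invr l0; rewrite add0r => nl.
apply: contrapT => none; apply: nb3; exists n => // d d0.
apply: contrapT => nr; apply: none; exists d => // r r0 rd.
rewrite leNgt; apply/negP => H; apply: nr; exists r; split => //.
apply: le_lt_trans H; apply: lee_wpmul2r; first exact: outer_measure_ge0.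
rewrite lee_fin; apply: (growth_mono _ _ _ _ G).
  by rewrite mulr_ge0 ?powR_ge0// invr_ge0.
by rewrite ler_wpM2r ?powR_ge0// ltW.
Qed.
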